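(* Let $\bar A=(A_0,A_1)$ be a compatible couple of (quasi-)Banach spaces with $A_0\cap A_1\neq\{0\}$. Let $0<\theta_0<\theta_1<1$, $0<q_1,r_0,r_1,r\le\infty$, $a,a_1,b_0,b_1\in SV$, and $\left\|s^{-1/r_1}\frac{b_1(s)}{a_1(s)}\right\|_{r_1,(0,1)}<\infty$. Put $c_1(t)=a_1(t)\left\|s^{-1/r_1}\frac{b_1(s)}{a_1(s)}\right\|_{r_1,(0,t)}$ and $\rho(t)=t^{\theta_1-\theta_0}\frac{b_0(t)}{c_1(t)}$ for $t>0$. (i) If $0<\theta<1$, then $$\left(\bar A_{\theta_0,r_0,b_0},\bar A^{\mathcal R}_{\theta_1,r_1,b_1,q_1,a_1}\right)_{\theta,r,a}\cong\bar A_{\eta,r,a^{\#}},$$ where $\eta=(1-\theta)\theta_0+\theta\theta_1$ and $a^{\#}(t)\approx b_0(t)^{1-\theta}c_1(t)^{\theta}a(\rho(t))$. (ii) If additionally $\left\|s^{-1/r}a(s)\right\|_{r,(1,\infty)}<\infty$, then $$\left(\bar A_{\theta_0,r_0,b_0},\bar A^{\mathcal R}_{\theta_1,r_1,b_1,q_1,a_1}\right)_{0,r,a}\cong\bar A^{\mathcal L}_{\theta_0,r,a^{\#},r_0,b_0},$$ where $a^{\#}(t)\approx b_0(t)a(\rho(t))$.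
   Context: For a compatible couple $\bar X=(X_0,X_1)$ of (quasi-)Banach spaces, $f\in X_0+X_1$ and $t>0$, $K(t,f)=K(t,f;\bar X)=\inf\{\|f_0\|_{X_0}+t\|f_1\|_{X_1}: f=f_0+f_1,\ f_i\in X_i\}$. $\|\cdot\|_{q,(c,d)}$ ($0<q\le\infty$) is the usual (quasi-)norm of the Lebesgue space $L_q$ on the interval $(c,d)$ with Lebesgue measure (variable of integration: the displayed variable; $1/\infty=0$). For positive functions, $f\approx g$ (equivalence) means that each is bounded by a constant multiple of the other. $SV$ is the set of positive Lebesgue measurable functions $b$ on $(0,\infty)$ that are slowly varying: for each $\varepsilon>0$, $t^{\varepsilon}b(t)$ is equivalent to an increasing function and $t^{-\varepsilon}b(t)$ is equivalent to a decreasing function. For $0\le\theta\le1$, $0<q\le\infty$, $b\in SV$, $\bar X_{\theta,q,b}=(X_0,X_1)_{\theta,q,b}$ is the space of $f\in X_0+X_1$ with $\|f\|=\left\|u^{-\theta-1/q}b(u)K(u,f)\right\|_{q,(0,\infty)}<\infty$. For $0<\sigma<1$, $0<r,q\le\infty$, $a,b\in SV$, $\bar X^{\mathcal L}_{\sigma,r,b,q,a}$ is the space of $f\in X_0+X_1$ with $\|f\|=\left\|t^{-1/r}\frac{b(t)}{a(t)}\left\|u^{-\sigma-1/q}a(u)K(u,f)\right\|_{q,(0,t)}\right\|_{r,(0,\infty)}<\infty$, and $\bar X^{\mathcal R}_{\sigma,r,b,q,a}$ is the space of $f\in X_0+X_1$ with $\|f\|=\left\|t^{-1/r}\frac{b(t)}{a(t)}\left\|u^{-\sigma-1/q}a(u)K(u,f)\right\|_{q,(t,\infty)}\right\|_{r,(0,\infty)}<\infty$.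 $X\cong Y$ means that $X$ and $Y$ are continuously embedded in each other (same space, equivalent quasi-norms). The spaces depend on $a^{\#}$ only up to equivalence, so $a^{\#}$ may be any positive measurable function equivalent to the indicated expression. *)

(* Defs.v *)
From mathcomp Require Import all_boot all_order all_algebra.
From mathcomp Require Import all_classical all_reals all_analysis.

Set Implicit Arguments.
Unset Strict Implicit.
Unset Printing Implicit Defensive.

Import Order.TTheory GRing.Theory Num.Theory.
Import numFieldNormedType.Exports.

Local Open Scope classical_set_scope.
Local Open Scope ring_scope.

(** ** Functions on the half-line (0, +oo) *)

(** The real line with the Lebesgue sigma-algebra; the library's default
    sigma-algebra on [R] is the Borel one. *)
Notation lebesgueType R :=
  (caratheodory_type ((wlength (idfun : R -> R))^*)%mu).

(** Only the values of functions on (0, +oo) are ever relevant. *)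
Definition positive_measurable (R : realType) (b : R -> R) : Prop :=
  measurable_fun (`]0, +oo[%classic : set (lebesgueType R))
    (b : lebesgueType R -> measurableTypeR R) /\
  (forall t, 0 < t -> 0 < b t).

Definition equivalent (R : realType) (f g : R -> R) : Prop :=
  exists2 C : R, 0 < C &
    forall t, 0 < t -> f t <= C * g t /\ g t <= C * f t.

Definition slowly_varying (R : realType) (b : R -> R) : Prop :=
  positive_measurable b /\
  forall e : R, 0 < e ->
    (exists2 g : R -> R, {in `]0, +oo[ &, {homo g : x y / x <= y}} &
       equivalent (fun t => t `^ e * b t) g) /\
    (exists2 g : R -> R, {in `]0, +oo[ &, {homo g : x y /~ x <= y}} &
       equivalent (fun t => t `^ (- e) * b t) g).

(** [1/q] as a real number, with [1/+oo = 0]. *)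
Definition rinv (R : realType) (q : \bar R) : R := fine (q^-1)%E.

(** The (quasi-)norm of [L_q(D)] for Lebesgue measure. *)
Definition Lq_norm (R : realType) (q : \bar R) (D : set R) (g : R -> \bar R)
    : \bar R :=
  ('N[@completed_lebesgue_measure R]_q[g \_ D])%E.

(** ** Quasi-normed spaces and couples *)

(** A space of vectors of [E] given by its underlying set and its quasi-norm;
    the values of [qnorm] outside of [carrier] carry no meaning. *)
Record qspace (R : realType) (E : lmodType R) := QSpace {
  carrier : set E;
  qnorm : E -> \bar R }.

(** Scalars are real: complex spaces are covered by restriction of scalars,
    which changes neither the sets nor the quasi-norms. *)
Record quasi_banach (R : realType) (E : lmodType R) (X : qspace E) : Prop := {
  carrier0 : carrier X 0;
  carrierD : forall x y, carrier X x -> carrier X y -> carrier X (x + y);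
  carrierZ : forall (c : R) x, carrier X x -> carrier X (c *: x);
  qnorm_fin : forall x, carrier X x -> qnorm X x \is a fin_num;
  qnorm_ge0 : forall x, carrier X x -> (0 <= qnorm X x)%E;
  qnorm_eq0 : forall x, carrier X x -> qnorm X x = 0%E -> x = 0;
  qnormZ : forall (c : R) x, carrier X x ->
    qnorm X (c *: x) = (`|c|%:E * qnorm X x)%E;
  qnormD : exists C : R, forall x y, carrier X x -> carrier X y ->
    (qnorm X (x + y) <= C%:E * (qnorm X x + qnorm X y))%E;
  qcomplete : forall u : nat -> E, (forall n, carrier X (u n)) ->
    (forall e : R, 0 < e -> exists N : nat, forall m n : nat,
       (N <= m)%N -> (N <= n)%N -> (qnorm X (u m - u n) < e%:E)%E) ->
    exists2 l, carrier X l & (qnorm X (u n - l) @[n --> \oo] --> 0)%E }.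

(** Continuity (at 0, hence everywhere) of the inclusion of [X] in [E]. *)
Definition continuously_included (R : realType) (E : topologicalLmodType R)
    (X : qspace E) : Prop :=
  forall U : set E, nbhs (0 : E) U -> exists2 d : R, 0 < d &
    forall x, carrier X x -> (qnorm X x < d%:E)%E -> U x.

Definition compatible_couple (R : realType) (E : topologicalLmodType R)
    (A0 A1 : qspace E) : Prop :=
  [/\ hausdorff_space E, quasi_banach A0, quasi_banach A1,
      continuously_included A0 & continuously_included A1].

Definition embedded (R : realType) (E : lmodType R) (X Y : qspace E) : Prop :=
  carrier X `<=` carrier Y /\
  exists C : R, forall f, carrier X f -> (qnorm Y f <= C%:E * qnorm X f)%E.

Definition same_space (R : realType) (E : lmodType R) (X Y : qspace E) : Prop :=
  embedded X Y /\ embedded Y X.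

(** ** Interpolation spaces *)

Definition sum_set (R : realType) (E : lmodType R) (X0 X1 : qspace E) : set E :=
  [set f | exists f0 f1, [/\ carrier X0 f0, carrier X1 f1 & f = f0 + f1]].

Definition Kfun (R : realType) (E : lmodType R) (X0 X1 : qspace E)
    (t : R) (f : E) : \bar R :=
  ereal_inf [set x | exists f0 f1,
    [/\ carrier X0 f0, carrier X1 f1, f = f0 + f1 &
        x = (qnorm X0 f0 + t%:E * qnorm X1 f1)%E]].

Definition finite_part (R : realType) (E : lmodType R) (X0 X1 : qspace E)
    (N : E -> \bar R) : qspace E :=
  QSpace [set f | sum_set X0 X1 f /\ (N f < +oo)%E] N.

(** [u^(-theta - 1/q) b(u) K(u, f)] *)
Definition Kweighted (R : realType) (E : lmodType R) (X0 X1 : qspace E)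
    (theta : R) (q : \bar R) (b : R -> R) (f : E) (u : R) : \bar R :=
  ((u `^ (- theta - rinv q) * b u)%:E * Kfun X0 X1 u f)%E.

Definition interp (R : realType) (E : lmodType R) (X0 X1 : qspace E)
    (theta : R) (q : \bar R) (b : R -> R) : qspace E :=
  finite_part X0 X1 (fun f =>
    Lq_norm q `]0, +oo[ (Kweighted X0 X1 theta q b f)).

Definition interpL (R : realType) (E : lmodType R) (X0 X1 : qspace E)
    (sigma : R) (r : \bar R) (b : R -> R) (q : \bar R) (a : R -> R) : qspace E :=
  finite_part X0 X1 (fun f =>
    Lq_norm r `]0, +oo[ (fun t => (t `^ (- rinv r) * (b t / a t))%:E *
      Lq_norm q `]0%R, t[ (Kweighted X0 X1 sigma q a f))%E).

Definition interpR (R : realType) (E : lmodType R) (X0 X1 : qspace E)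
    (sigma : R) (r : \bar R) (b : R -> R) (q : \bar R) (a : R -> R) : qspace E :=
  finite_part X0 X1 (fun f =>
    Lq_norm r `]0, +oo[ (fun t => (t `^ (- rinv r) * (b t / a t))%:E *
      Lq_norm q `]t, +oo[ (Kweighted X0 X1 sigma q a f))%E).

(** [|| s^(-1/r) w(s) ||_{r, D}] *)
Definition weight_norm (R : realType) (r : \bar R) (w : R -> R) (D : set R)
    : \bar R :=
  Lq_norm r D (fun s => (s `^ (- rinv r) * w s)%:E).

(** [a(t) || s^(-1/r) b(s)/a(s) ||_{r, (0,t)}].  For slowly varying [a], [b]
    the norms over (0,t), [t > 0], are all finite as soon as the one over (0,1)
    is, and then [fine] loses nothing. *)
Definition cfun (R : realType) (r : \bar R) (a b : R -> R) (t : R) : R :=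
  a t * fine (weight_norm r (fun s => b s / a s) `]0, t[).

Definition rhofun (R : realType) (theta0 theta1 : R) (b0 c1 : R -> R) (t : R)
    : R :=
  t `^ (theta1 - theta0) * (b0 t / c1 t).

(* Main.v *)
(** The norms are discretized at the points [exp k], [k] an integer: there the
    weights, the K-functional and all inner norms change by bounded factors,
    so that every norm becomes an [l^q] norm over the integers.  Put
    [x_j = e^(-j theta0) b0(e^j) K(e^j, f)], let [I_k] be the [l^r0] norm of [x]
    over [j <= k] and [rho_k = rho(e^k)].  Splitting [f] as for [K(e^k, f)]
    gives, for every small [eps > 0], the Holmstedt-type estimates
    [I_k <~ K(rho_k, f; X0, X1) <~ I_k + sup_(j >= k) (rho_k / rho_j) e^(eps (j - k)) x_j].
    Since [rho] is regularly varying of index [theta1 - theta0 > 0], the outer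
    norm in [v] can be sampled at [v = rho_k].  The supremum, and for
    [theta > 0] also [I_k], is then absorbed by a Schur test (a discrete Hardy
    inequality), as the weights [rho_k^(-theta) a(rho_k)] decay and
    [rho_k^(1 - theta) a(rho_k)] grow geometrically.  *)
Require Import Defs.
From mathcomp Require Import all_boot all_order all_algebra.
From mathcomp Require Import all_classical all_reals all_analysis.
From mathcomp Require Import measurable_realfun ess_sup_inf.
From mathcomp Require Import zify ring lra.

Import Order.TTheory GRing.Theory Num.Theory.
Import numFieldNormedType.Exports.

Local Open Scope classical_set_scope.
Local Open Scope ring_scope.

(** ** Sequences indexed by the integers *)

(** The exponents range over [(0, +oo]] and are unrelated to each other, so neither duality nor
    Minkowski's inequality is available throughout. Norms are therefore compared through
    geometrically decaying sequences, whose [l^q] norm is of the size of their peak for every [q]. A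
    sharp Holmstedt formula would carry the nested tail norm of [X1]; the supremum with the surplus
    [e^(eps (j - k))] is cruder, but it makes the tail geometric, so that this norm collapses to one
    level. The loss is harmless because [theta < 1] lets [rho_k^(1 - theta)] outgrow the surplus. At
    [theta = 0] there is no such room on the other side: [I_k] cannot be absorbed and survives as
    the inner norm of the [L] space. Slow variation is used in the form of Potter bounds, which
    survive products, powers, primitives and the composition [a(rho)]. As [rho] may be neither
    monotone nor continuous, it is inverted only up to bounded errors on the logarithmic scale. The
    couple [(X0, X1)] enters through the nonnegativity of its norms and their discrete forms, and
    the upper estimate has to produce the membership of [f] in [X0 + X1] as well. *)

(* Clamping at [0] makes [lq] monotone without sign conditions. *)
Definition lq (R : realType) (q : \bar R) (x : int -> \bar R) : \bar R :=
  if q is r%:E then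
    ((\esum_(k in [set: int]) (maxe 0 (x k)) `^ r) `^ r^-1)%E
  else ereal_sup (range (fun k => maxe 0%E (x k))).

Arguments lq {R} q x.

Section esum_complements.
Context {R : realType}.
Local Open Scope ereal_scope.

Lemma esumZ_le (T : choiceType) (A : set T) (f : T -> \bar R) (c : R) :
  (0 <= c)%R -> (forall k, 0 <= f k) ->
  \esum_(k in A) (c%:E * f k) <= c%:E * \esum_(k in A) f k.
Proof.
move=> c0 f0; apply: ge_ereal_sup => _ [F FA <-].
rewrite -ge0_mule_fsumr//; apply: lee_wpmul2l => //.
by apply: esum_ge; exists F.
Qed.

Lemma esum_point (T : choiceType) (f : T -> \bar R) k :
  (forall k, 0 <= f k) -> f k <= \esum_(j in [set: T]) f j.
Proof.
by move=> f0; apply: esum_ge; exists [set k]; rewrite ?fsbig_set1.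
Qed.

Lemma exchange_esum (T T' : choiceType) (a : T -> T' -> \bar R) :
  (forall i j, 0 <= a i j) ->
  \esum_(i in [set: T]) \esum_(j in [set: T']) a i j =
  \esum_(j in [set: T']) \esum_(i in [set: T]) a i j.
Proof.
move=> a0; rewrite (@esum_esum _ _ _ setT (fun=> setT))//.
rewrite (@esum_esum _ _ _ setT (fun=> setT) (fun j i => a i j))//.
rewrite (reindex_esum (setT `*`` (fun=> setT)) _ (fun x => (x.2, x.1)))//.
split=> //=; first by move=> [i1 i2] [j1 j2] /= _ _ [] -> ->.
by move=> [i j] _; exists (j, i).
Qed.

Lemma esum_shift (f : int -> \bar R) (m : int) :
  \esum_(k in [set: int]) f (k - m)%R = \esum_(k in [set: int]) f k.
Proof.
rewrite (@reindex_esum _ _ _ setT setT (fun k : int => (k - m)%R) f)//.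
split=> //=; first by move=> x y _ _ /addIr.
by move=> y _; exists (y + m)%R => //; rewrite addrK.
Qed.

Lemma geometric_esum (e : R) : (0 < e)%R ->
  exists2 B : R, (0 < B)%R & forall m : int,
  \esum_(k in [set: int]) (expR (- (e * `|(k - m)%:~R|)))%:E <= B%:E.
Proof.
move=> e0; pose z := expR (- e).
have z1 : (`|z| < 1)%R.
  by rewrite ger0_norm ?expR_ge0// -expR0 ltr_expR oppr_lt0.
have z0 : (0 < 1 - z)%R.
  by rewrite subr_gt0; apply: le_lt_trans z1; rewrite ler_norm.
have fz (n : nat) : expR (- (e * n%:R)) = (z ^+ n)%R.
  by rewrite -expRM_natr mulNr.
have geo : \esum_(n in [set: nat]) (z ^+ n)%:E = ((1 - z)^-1)%:E.
  rewrite -nneseries_esumT; last by move=> n; rewrite lee_fin exprn_ge0 ?expR_ge0.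
  apply: cvg_lim => //.
  have := @cvg_geometric_series R 1 z z1; rewrite div1r => h.
  apply: cvg_EFin; first by near=> n; rewrite sumEFin.
  rewrite [X in X @ _ --> _](_ : _ = series (geometric 1%R z))//.
  by apply/funext => n /=; rewrite sumEFin /series/=; apply: eq_bigr => i _; rewrite mul1r.
(* One geometric series of ratio [z] for each sign of [k]. [Negz n] stands for [- (n + 1)]; its
   extra factor [z] is given away. *)
exists (2 * (1 - z)^-1)%R; first by rewrite mulr_gt0// invr_gt0.
move=> m; rewrite (esum_shift (fun k => (expR (- (e * `|k%:~R|)))%:E)).
rewrite (esumID [set k : int | (0 <= k)%R]) ?setTI => [|i _]; last by rewrite lee_fin expR_ge0.
rewrite (@reindex_esum _ _ _ setT [set k : int | (0 <= k)%R] Posz); last first.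
  split => [n _ //=|x y _ _ [] //|[n|n]//= _]; by exists n.
rewrite (@reindex_esum _ _ _ setT (~` [set k : int | (0 <= k)%R]) Negz); last first.
  split => [n _ //=|x y _ _ [] //|[n|n]//= h]; last by exists n.
rewrite mulr_natl mulr2n EFinD -geo; apply: leeD.
  by apply: le_esum => n _; rewrite lee_fin ger0_norm ?ler0z// fz.
apply: le_esum => n _; rewrite lee_fin -fz ler_expR lerN2 ler_pM2l// NegzE.
by rewrite rmorphN normrN ger0_norm ?ler0z// ler_nat.
Unshelve. all: by end_near. Qed.

End esum_complements.

Section lq.
Context {R : realType}.
Local Open Scope ereal_scope.
Implicit Types (x y : int -> \bar R) (q M : \bar R).

Lemma poweR_le (r : R) (a b : \bar R) :
  (0 <= r)%R -> 0 <= a -> a <= b -> a `^ r <= b `^ r.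
Proof.
move=> r0 a0 ab; apply: gt0_ler_poweR => //.
- by rewrite in_itv/= a0 leey.
- by rewrite in_itv/= (le_trans a0 ab) leey.
Qed.

Lemma poweRK (r : R) (a : \bar R) : (0 < r)%R -> 0 <= a -> (a `^ r) `^ r^-1 = a.
Proof. by move=> r0 a0; rewrite -poweRrM divff ?gt_eqF// poweRe1. Qed.

Lemma poweRVK (r : R) (a : \bar R) : (0 < r)%R -> 0 <= a -> (a `^ r^-1) `^ r = a.
Proof. by move=> r0 a0; rewrite -poweRrM mulVf ?gt_eqF// poweRe1. Qed.

Lemma le_maxe0 (a b : \bar R) : a <= b -> maxe 0 a <= maxe 0 b.
Proof. by move=> ab; rewrite ge_max !le_max lexx ab orbT. Qed.

Lemma maxe0_ge0 (a : \bar R) : 0 <= maxe 0 a.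
Proof. by rewrite le_max lexx. Qed.

Lemma q_cases q : 0 < q -> q = +oo \/ exists2 r : R, (0 < r)%R & q = r%:E.
Proof. by case: q => [r| |]//; [right; exists r|left]. Qed.

Lemma lq_ge0 q x : 0 < q -> 0 <= lq q x.
Proof.
move=> /q_cases[->|[r r0 ->]]/=; last exact: poweR_ge0.
apply: (@le_trans _ _ (maxe 0 (x 0%R))); first exact: maxe0_ge0.
by apply: ereal_sup_ubound; exists 0%R.
Qed.

Lemma lq_le q x y : 0 < q -> (forall k, x k <= y k) -> lq q x <= lq q y.
Proof.
move=> /q_cases[->|[r r0 ->]] xy/=.
  apply: ge_ereal_sup => _ [k _ <-].
  by apply: (le_trans (le_maxe0 _ _ (xy k))); apply: ereal_sup_ubound; exists k.
apply: poweR_le; first by rewrite invr_ge0 ltW.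
  by apply: esum_ge0 => k _; exact: poweR_ge0.
apply: le_esum => k _; apply: poweR_le; rewrite ?maxe0_ge0 ?(ltW r0)//.
exact: le_maxe0.
Qed.

Lemma lq_point q x k : 0 < q -> x k <= lq q x.
Proof.
move=> /q_cases[->|[r r0 ->]]/=.
  apply: (@le_trans _ _ (maxe 0 (x k))); first by rewrite le_max lexx orbT.
  by apply: ereal_sup_ubound; exists k.
apply: (@le_trans _ _ (maxe 0 (x k))); first by rewrite le_max lexx orbT.
rewrite -[leLHS](poweRK r) ?maxe0_ge0//; apply: poweR_le.
- by rewrite invr_ge0 ltW.
- exact: poweR_ge0.
- by apply: (esum_point int (fun k => (maxe 0 (x k)) `^ r)) => j; exact: poweR_ge0.
Qed.

Lemma maxe0M (c : R) (a : \bar R) : (0 <= c)%R ->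
  maxe 0 (c%:E * a) = c%:E * maxe 0 a.
Proof. by move=> c0; rewrite -[X in maxe X _ = _](mule0 c%:E) maxe_pMr. Qed.

Lemma lq_scale q x (c : R) : 0 < q -> (0 <= c)%R ->
  lq q (fun k => c%:E * x k) <= c%:E * lq q x.
Proof.
move=> /q_cases[->|[r r0 ->]] c0/=.
  apply: ge_ereal_sup => _ [k _ <-]; rewrite maxe0M//; apply: lee_wpmul2l => //.
  by apply: ereal_sup_ubound; exists k.
rewrite -[leRHS](poweRK r)//; last first.
  by rewrite mule_ge0 ?poweR_ge0.
apply: poweR_le; first by rewrite invr_ge0 ltW.
  by apply: esum_ge0 => k _; exact: poweR_ge0.
rewrite poweRM// ?poweR_ge0// poweRVK//; last first.
  by apply: esum_ge0 => k _; exact: poweR_ge0.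
rewrite poweR_EFin; apply: le_trans (esumZ_le _ _ _ _ (powR_ge0 _ _) _); last first.
  by move=> k; exact: poweR_ge0.
by apply: le_esum => k _; rewrite maxe0M// poweRM ?maxe0_ge0.
Qed.

Lemma lq_dom q x y (c : R) : 0 < q -> (0 <= c)%R ->
  (forall k, x k <= c%:E * y k) -> lq q x <= c%:E * lq q y.
Proof.
by move=> q0 c0 xy; apply: le_trans (lq_scale _ _ _ q0 c0); exact: lq_le.
Qed.

Lemma lq_scale_ge q x (c : R) : 0 < q -> (0 <= c)%R ->
  c%:E * lq q x <= lq q (fun k => c%:E * x k).
Proof.
move=> q0; rewrite le_eqVlt => /predU1P[<-|c0]; first by rewrite mul0e lq_ge0.
have ci0 : (0 <= c^-1)%R by rewrite invr_ge0 ltW.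
rewrite -lee_pdivlMl//; apply: le_trans (lq_scale _ _ _ q0 ci0).
by apply: lq_le => // k; rewrite muleA -EFinM mulVf ?gt_eqF// mul1e.
Qed.

Lemma two_mule (a : \bar R) : 2%:E * a = a + a.
Proof. by rewrite -[2%R]/(2%:R)%R mule_natl mule2n. Qed.

Lemma lq_add q : 0 < q -> exists2 C : R, (0 < C)%R & forall x y,
  lq q (fun k => x k + y k) <= C%:E * (lq q x + lq q y).
Proof.
move=> q0; case: (q_cases _ q0) => [qE|[r r0 qE]].
  exists 1%R => // x y; rewrite mul1e qE/=.
  apply: ge_ereal_sup => _ [k _ <-].
  apply: (@le_trans _ _ (maxe 0 (x k) + maxe 0 (y k))).
    rewrite ge_max adde_ge0 ?maxe0_ge0//=; apply: leeD; by rewrite le_max lexx orbT.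
  by apply: leeD; apply: ereal_sup_ubound; exists k.
(* [x + y <= 2 max(x, y)], and [(s + t)^(1/r) <= (2 max(s, t))^(1/r)] *)
exists (2 * 2 `^ r^-1)%R; first by rewrite mulr_gt0// powR_gt0.
move=> x y; pose S (z : int -> \bar R) := \esum_(k in [set: int]) (maxe 0 (z k)) `^ r.
have S0 z : 0 <= S z by apply: esum_ge0 => k _; exact: poweR_ge0.
have Sadd : S (fun k => x k + y k) <= (2 `^ r)%:E * (S x + S y).
  rewrite /S -esumD; do ?by move=> i _; exact: poweR_ge0.
  apply: le_trans (esumZ_le _ _ _ _ (powR_ge0 _ _) _); last first.
    by move=> k; rewrite adde_ge0 ?poweR_ge0.
  apply: le_esum => k _; set a := maxe 0 (x k); set b := maxe 0 (y k).
  have a0 : 0 <= a by exact: maxe0_ge0. have b0 : 0 <= b by exact: maxe0_ge0.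
  have ab : maxe 0 (x k + y k) <= 2%:E * maxe a b.
    have [am bm] : a <= maxe a b /\ b <= maxe a b by split; rewrite le_max lexx ?orbT.
    rewrite ge_max two_mule; apply/andP; split.
      by apply: adde_ge0; exact: le_trans am.
    by apply: leeD; [apply: le_trans am|apply: le_trans bm]; rewrite le_max lexx orbT.
  apply: (le_trans (poweR_le r _ _ (ltW r0) (maxe0_ge0 _) ab)).
  have m0 : 0 <= maxe a b by rewrite le_max a0.
  rewrite poweRM// poweR_EFin lee_wpmul2l ?lee_fin ?powR_ge0//.
  by case: (leP a b) => _; [rewrite leeDr|rewrite leeDl]; rewrite ?poweR_ge0.
rewrite qE /lq -/(S x) -/(S y) -/(S (fun k => x k + y k)).
have ri0 : (0 <= r^-1)%R by rewrite invr_ge0 ltW.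
have hm : S x + S y <= 2%:E * maxe (S x) (S y).
  by rewrite two_mule leeD// le_max lexx ?orbT.
have h2 : S (fun k => x k + y k) <= (2 `^ r)%:E * (2%:E * maxe (S x) (S y)).
  by apply: (le_trans Sadd); rewrite lee_wpmul2l ?lee_fin ?powR_ge0.
apply: (le_trans (poweR_le _ _ _ ri0 (S0 _) h2)).
have m0 : 0 <= maxe (S x) (S y) by rewrite le_max S0.
rewrite poweRM ?mule_ge0 ?lee_fin ?powR_ge0// poweRM// !poweR_EFin -powRrM.
rewrite divff ?gt_eqF// powRr1// muleA -EFinM lee_wpmul2l ?lee_fin ?mulr_ge0 ?powR_ge0//.
by case: (leP (S x) (S y)) => _; [rewrite leeDr|rewrite leeDl]; rewrite ?poweR_ge0.
Qed.

(** The [r]-th powers lie below a two-sided geometric series of ratio [expR (- (e * r))], whose sum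
    does not depend on the centre [m]. This replaces the norm of a geometrically decaying sequence
    by its peak, for all [q] alike. *)
Lemma lq_geo q (e : R) : 0 < q -> (0 < e)%R ->
  exists2 C : R, (0 < C)%R & forall x (m : int) M, 0 <= M ->
  (forall k, x k <= (expR (- (e * `|(k - m)%:~R|)))%:E * M) ->
  lq q x <= C%:E * M.
Proof.
move=> q0 e0; case: (q_cases _ q0) => [qE|[r r0 qE]].
  exists 1%R => // x m M M0 h; rewrite mul1e qE /=.
  apply: ge_ereal_sup => _ [k _ <-]; rewrite ge_max M0/=.
  apply: (le_trans (h k)); rewrite gee_pMl// ?fin_numE//; last first.
    by rewrite lee_fin -expR0 ler_expR oppr_le0 mulr_ge0// ltW.
have [B B0 hB] := geometric_esum (e * r) (mulr_gt0 e0 r0).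
exists (B `^ r^-1)%R; first by rewrite powR_gt0.
move=> x m M M0 h; rewrite qE /=.
case: M M0 h => [M| |]// M0 h; last first.
  by rewrite gt0_muley ?leey// lte_fin powR_gt0.
have -> : (B `^ r^-1)%:E * M%:E = (B%:E * (M `^ r)%:E) `^ r^-1.
  rewrite -[(M `^ r)%:E]poweR_EFin poweRM; last 2 first.
  - by rewrite lee_fin ltW.
  - exact: poweR_ge0.
  by rewrite poweRK// poweR_EFin.
apply: poweR_le; first by rewrite invr_ge0 ltW.
  by apply: esum_ge0 => k _; exact: poweR_ge0.
apply: (@le_trans _ _ ((M `^ r)%:E *
    \esum_(k in [set: int]) (expR (- (e * r * `|(k - m)%:~R|)))%:E)); last first.
  by rewrite muleC lee_wpmul2r ?lee_fin ?powR_ge0.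
apply: le_trans (esumZ_le _ _ _ _ (powR_ge0 _ _) _); last first.
  by move=> k; rewrite lee_fin expR_ge0.
apply: le_esum => k _.
have h' : maxe 0 (x k) <= (expR (- (e * `|(k - m)%:~R|)))%:E * M%:E.
  by rewrite ge_max h andbT mule_ge0 ?lee_fin ?expR_ge0.
apply: (le_trans (poweR_le r _ _ (ltW r0) (maxe0_ge0 _) h')).
rewrite -EFinM poweR_EFin powRM ?expR_ge0// -EFinM lee_fin mulrC.
by rewrite ler_wpM2l ?powR_ge0// -expRM mulNr mulrAC.
Qed.

(* The [l^q] norm dominates the supremum, so this covers kernels acting by a
   supremum as well. *)
Lemma lq_schur q (e : R) : 0 < q -> (0 < e)%R ->
  exists2 C : R, (0 < C)%R & forall (tau : int -> int) x y,
  (forall k, x k <= lq q (fun j =>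
     (expR (- (e * `|(k - tau j)%:~R|)))%:E * y j)) ->
  lq q x <= C%:E * lq q y.
Proof.
move=> q0 e0; case: (q_cases _ q0) => [qE|[r r0 qE]].
  exists 1%R => // tau x y; rewrite mul1e qE /= => h.
  apply: ge_ereal_sup => _ [k _ <-]; rewrite ge_max; apply/andP; split.
    by rewrite -[ereal_sup _]/(lq +oo y) lq_ge0.
  apply: (le_trans (h k)); apply: ge_ereal_sup => _ [j _ <-].
  apply: (@le_trans _ _ (maxe 0 (y j))); last by apply: ereal_sup_ubound; exists j.
  rewrite maxe0M ?expR_ge0// gee_pMl// ?fin_numE// ?maxe0_ge0//.
  by rewrite lee_fin -expR0 ler_expR oppr_le0 mulr_ge0// ltW.
have [B B0 hB] := geometric_esum (e * r) (mulr_gt0 e0 r0).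
exists (B `^ r^-1)%R; first by rewrite powR_gt0.
move=> tau x y; rewrite qE /= => h.
rewrite -poweR_EFin -poweRM ?lee_fin ?(ltW B0)//; last first.
  by apply: esum_ge0 => k _; exact: poweR_ge0.
apply: poweR_le; first by rewrite invr_ge0 ltW.
  by apply: esum_ge0 => k _; exact: poweR_ge0.
pose a (k j : int) := (expR (- (e * r * `|(k - tau j)%:~R|)))%:E * (maxe 0 (y j)) `^ r.
have a0 k j : 0 <= a k j by rewrite mule_ge0 ?lee_fin ?expR_ge0 ?poweR_ge0.
apply: (@le_trans _ _ (\esum_(k in [set: int]) \esum_(j in [set: int]) a k j)).
  apply: le_esum => k _.
  have h' : maxe 0 (x k) <= (\esum_(j in [set: int]) a k j) `^ r^-1.
    rewrite ge_max poweR_ge0/=; apply: (le_trans (h k)).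
    rewrite le_eqVlt; apply/orP; left; apply/eqP; congr (_ `^ _).
    apply: eq_esum => j _; rewrite maxe0M ?expR_ge0// poweRM ?lee_fin ?expR_ge0 ?maxe0_ge0//.
    by rewrite poweR_EFin -expRM /a mulNr mulrAC.
  apply: (le_trans (poweR_le r _ _ (ltW r0) (maxe0_ge0 _) h')).
  by rewrite poweRVK//; apply: esum_ge0.
(* Only the sums over [k] with [j] fixed enter now, and they are at most [B] wherever [tau j] lies.
   Since both sides were raised to the power [r] beforehand, [r < 1] is covered. *)
rewrite exchange_esum//.
apply: le_trans (esumZ_le _ _ _ _ (ltW B0) _); last first.
  by move=> k; exact: poweR_ge0.
apply: le_esum => j _.
case tE: (maxe 0 (y j)) (maxe0_ge0 (y j)) => [t| |]// t0.
  apply: (@le_trans _ _ ((t `^ r)%:E *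
      \esum_(k in [set: int]) (expR (- (e * r * `|(k - tau j)%:~R|)))%:E)); last first.
    by rewrite poweR_EFin muleC lee_wpmul2r ?lee_fin ?powR_ge0.
  apply: le_trans (esumZ_le _ _ _ _ (powR_ge0 _ _) _); last first.
    by move=> k; rewrite lee_fin expR_ge0.
  by apply: le_esum => k _; rewrite /a tE poweR_EFin muleC.
by rewrite poweRyr ?gt_eqF// gt0_muley ?leey.
Qed.

End lq.

(** ** Discretization of norms on the half-line *)

Definition epoint (R : realType) (k : int) : R := expR k%:~R.
Arguments epoint {R} k.

Definition log_floor (R : realType) (u : R) : int := Num.floor (ln u).
Arguments log_floor {R} u.

(* The norm of [h] in [L_q(D, du/u)]. *)
Definition haar_norm (R : realType) (q : \bar R) (D : set R) (h : R -> \bar R)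
    : \bar R :=
  Lq_norm q D (fun u => ((u `^ (- rinv q))%:E * h u)%E).
Arguments haar_norm {R} q D h.

Section discretization.
Context {R : realType}.
Local Notation mu := (@completed_lebesgue_measure R).

Lemma epoint_gt0 k : (0 : R) < epoint k. Proof. exact: expR_gt0. Qed.

Lemma ln_epoint k : ln (epoint k : R) = k%:~R. Proof. exact: expRK. Qed.

Lemma log_floor_epoint k : log_floor (epoint k : R) = k.
Proof. by rewrite /log_floor ln_epoint intrKfloor. Qed.

Lemma log_floorE (u : R) k : 0 < u ->
  (log_floor u == k) = (epoint k <= u < epoint (k + 1)).
Proof.
by move=> u0; rewrite /log_floor floor_eq -[u in RHS]lnK ?posrE// /epoint ler_expR ltr_expR.
Qed.

Lemma log_floor_itv (u : R) : 0 < u ->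
  epoint (log_floor u) <= u < epoint (log_floor u + 1).
Proof. by move=> u0; rewrite -log_floorE. Qed.


Lemma epointD1 k : epoint (k + 1) = expR 1 * epoint k :> R.
Proof. by rewrite /epoint intrD mulrC -expRD. Qed.

(* Without measurability [integral] is a lower integral, which is still monotone. *)
Lemma le_lower_integral (f g : R -> \bar R) :
  (forall u, 0 <= f u)%E -> (forall u, f u <= g u)%E ->
  (\int[mu]_u f u <= \int[mu]_u g u)%E.
Proof.
move=> f0 fg; rewrite !ge0_integralTE//; last by move=> u; exact: le_trans (fg u).
by apply: ereal_sup_le => _ [h /= hf <-]; exists h => //= u; exact: le_trans (fg u).
Qed.

Let cell k : set R := `[epoint k, epoint (k + 1)[%classic.

Let cellP k (u : R) : cell k u <-> 0 < u /\ log_floor u = k.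
Proof.
rewrite /cell/= in_itv/=; split=> [h|[u0 <-]]; last exact: log_floor_itv.
have u0 : 0 < u by case/andP: h => h _; apply: lt_le_trans h; exact: epoint_gt0.
by split=> //; apply/eqP; rewrite log_floorE.
Qed.

Let measurable_cell k :
  measurable (cell k : set (lebesgueType R)).
Proof. by apply: sub_caratheodory; exact: measurable_itv. Qed.

Let mu_cell k : mu (cell k) = ((expR 1 - 1) * epoint k)%:E.
Proof.
rewrite -[LHS]/(@lebesgue_measure R (cell k)) lebesgue_measure_itv/= lte_fin.
rewrite epointD1 ltr_pMl ?epoint_gt0// expR_gt1 ltr01 -EFinB.
by rewrite mulrBl mul1r.
Qed.

(** The half-line is the disjoint union of the cells [[e^k, e^(k+1))], of length
    [(expR 1 - 1) * epoint k], on which [log_floor] equals [k]; the rest is countable additivity. *)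
Lemma integral_log_step (y : int -> \bar R) : (forall k, 0 <= y k)%E ->
  (\int[mu]_(u in `]0%R, +oo[%classic) y (log_floor u) =
   \esum_(k in [set: int]) (((expR 1 - 1) * epoint k)%:E * y k))%E.
Proof.
move=> y0.
have [e ebij] : exists e : nat -> int, set_bij [set: nat] [set: int] e.
  (* Countable additivity is applied along [nat]: even numbers enumerate the nonnegative integers,
     odd numbers the negative ones. *)
  exists (fun n => if odd n then Negz n./2 else Posz n./2); split=> //=.
    move=> m n _ _; case: ifPn => om; case: ifPn => on // -[mn];
      rewrite -(odd_double_half m) -(odd_double_half n) mn.
      by rewrite om on.
    by rewrite (negbTE om) (negbTE on).
  move=> [n|n] _; [exists n.*2 => //|exists n.*2.+1 => //].
    by rewrite odd_double doubleK.
  by rewrite /= odd_double/= uphalf_double.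
have [_ einj esurj] := ebij.
have -> : `]0%R, +oo[%classic = \bigcup_n cell (e n).
  apply/seteqP; split=> [u/=|u [n _ /cellP[u0 _]]]; last by rewrite /= in_itv/= u0.
  rewrite in_itv/= andbT => u0; have [n _ en] := esurj (log_floor u) I.
  by exists n => //; apply/cellP.
have yE n u : cell (e n) u -> y (log_floor u) = y (e n) by move=> /cellP[_ ->].
rewrite ge0_integral_bigcup; last 4 first.
- by move=> n; exact: measurable_cell.
- apply/measurable_fun_bigcup => n; first exact: measurable_cell.
  apply: (eq_measurable_fun (cst (y (e n)))) => //.
  by move=> u; rewrite inE => /yE ->.
- by move=> u _; exact: y0.
- move=> i j _ _ [u [/cellP[_ hi] /cellP[_ hj]]].
  by apply: einj; rewrite ?inE// -hi.
rewrite (@reindex_esum _ _ _ setT setT e)//.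
rewrite nneseries_esumT; last by move=> n; exact: integral_ge0.
apply: eq_esum => n _.
rewrite (eq_integral (cst (y (e n)))); last by move=> u; rewrite inE => /yE.
rewrite [RHS]muleC integral_cst; last exact: measurable_cell.
by congr (_ * _)%E; exact: mu_cell.
Qed.

Lemma integral_log_stepT (y : int -> \bar R) : (forall k, 0 <= y k)%E ->
  (\int[mu]_u ((fun u => y (log_floor u)) \_ (`]0%R, +oo[%classic : set R)) u =
   \esum_(k in [set: int]) (((expR 1 - 1) * epoint k)%:E * y k))%E.
Proof. by move=> y0; rewrite -integral_mkcond integral_log_step. Qed.

Lemma rinvE (r : R) : 0 < r -> rinv r%:E = r^-1.
Proof. by move=> r0; rewrite /rinv inver gt_eqF. Qed.

Lemma rinvy : rinv (+oo%E : \bar R) = 0.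
Proof. by rewrite /rinv invey. Qed.

(** The power [r] turns the factor [u^(-1/r)] into the density [1/u] of the Haar measure [du/u]. *)
Let poweR_patch (r : R) (D : set R) (h : R -> \bar R) u : 0 < r ->
  (D u -> 0 < u /\ (0 <= h u)%E) ->
  (`|((fun u : R => (u `^ (- rinv r%:E))%R%:E * h u) \_ D) u| `^ r =
   if u \in D then (u^-1)%:E * (h u) `^ r else 0)%E.
Proof.
move=> r0 Dh; rewrite /patch; case: ifPn => [|_]; last first.
  by rewrite abse0 poweR0r// gt_eqF.
rewrite inE => /Dh[u0 h0].
rewrite gee0_abs ?mule_ge0 ?lee_fin ?powR_ge0// poweRM ?lee_fin ?powR_ge0//.
rewrite poweR_EFin -powRrM rinvE// mulNr mulVf ?gt_eqF//.
by rewrite powR_inv1// ltW.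
Qed.

Lemma haar_norm_le_lq q : (0 < q)%E -> exists2 C : R, 0 < C &
  forall (D : set R) (h : R -> \bar R) (x : int -> \bar R),
  (forall u, D u -> 0 < u /\ (0 <= h u /\ h u <= x (log_floor u))%E) ->
  (haar_norm q D h <= C%:E * lq q x)%E.
Proof.
move=> q0; case: (q_cases _ q0) => [qE|[r r0 qE]].
  exists 1 => // D h x Dh; rewrite mul1e /haar_norm /Lq_norm qE unlock.
  have lq0 : (0 <= lq +oo x)%E by rewrite lq_ge0.
  case: ifP => // _; apply/ess_supP; apply: aeW => u /=.
  rewrite /patch; case: ifPn; rewrite ?abse0// inE => /Dh[u0 [h0 hx]].
  rewrite rinvy oppr0 powRr0 mul1e gee0_abs//; apply: (le_trans hx).
  by apply: (lq_point +oo x).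
(* [c] bounds the Haar measure of a cell from above: its length is [c * epoint k], and [1/u] is at
   most [1 / epoint k] there. *)
pose c := expR 1 - 1 : R.
have c0 : 0 < c by rewrite subr_gt0 expR_gt1.
exists (c `^ r^-1); first by rewrite powR_gt0.
move=> D h x Dh; rewrite /haar_norm /Lq_norm qE unlock /=.
rewrite -poweR_EFin -poweRM ?lee_fin ?(ltW c0)//; last first.
  by apply: esum_ge0 => k _; exact: poweR_ge0.
apply: poweR_le; first by rewrite invr_ge0 ltW.
  by apply: integral_ge0 => u _; exact: poweR_ge0.
pose y k := ((epoint k : R)^-1%:E * (maxe 0 (x k)) `^ r)%E.
have y0 k : (0 <= y k)%E.
  by rewrite mule_ge0 ?poweR_ge0// lee_fin invr_ge0 ltW// epoint_gt0.
apply: (@le_trans _ _ (\esum_(k in [set: int]) ((c * epoint k)%:E * y k))%E).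
  rewrite -integral_log_stepT//; apply: le_lower_integral => u; first exact: poweR_ge0.
  rewrite poweR_patch//; last by move=> /Dh[? []].
  case: ifPn => [|_]; last by rewrite /patch; case: ifP.
  rewrite inE => /Dh[u0 [h0 hx]]; rewrite /patch mem_set /= ?in_itv/= ?u0//.
  have /andP[fu _] := log_floor_itv _ u0.
  apply: lee_pmul.
  - by rewrite lee_fin invr_ge0 ltW.
  - exact: poweR_ge0.
  - by rewrite lee_fin lef_pV2 ?posrE ?epoint_gt0.
  - by apply: poweR_le; rewrite ?(ltW r0)// (le_trans hx)// le_max lexx orbT.
apply: le_trans (esumZ_le _ _ _ _ (ltW c0) _); last by move=> k; exact: poweR_ge0.
apply: le_esum => k _; rewrite /y muleA -EFinM -mulrA divff ?mulr1//.
by rewrite gt_eqF// epoint_gt0.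
Qed.

(** The bound is asked only on cells where [x] is positive, so that [x] may be truncated to the
    cells lying inside [D]. *)
Lemma lq_le_haar_norm q : (0 < q)%E -> exists2 C : R, 0 < C &
  forall (D : set R) (h : R -> \bar R) (x : int -> \bar R),
  (forall u, D u -> 0 < u /\ (0 <= h u)%E) ->
  (forall u, 0 < u -> (0 < x (log_floor u))%E ->
    D u /\ (x (log_floor u) <= h u)%E) ->
  (lq q x <= C%:E * haar_norm q D h)%E.
Proof.
move=> q0; case: (q_cases _ q0) => [qE|[r r0 qE]].
  exists 1 => // D h x Dh xh; rewrite mul1e /haar_norm /Lq_norm qE unlock/=.
  have mu_cell_gt0 k : (0 < mu (cell k))%E.
    by rewrite mu_cell lte_fin mulr_gt0 ?epoint_gt0// subr_gt0 expR_gt1.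
  have -> : (0 < mu [set: R])%E.
    apply: (lt_le_trans (mu_cell_gt0 0)); apply: le_measure => //.
    - by rewrite inE; exact: measurable_cell.
    - by rewrite inE; exact: measurableT.
  set g := abse \o _.
  have g0 u : (0 <= g u)%E by exact: abse_ge0.
  (* A cell has positive measure, hence contains a point outside the null set on which the essential
     supremum is exceeded. *)
  have ae_ex k : exists2 u, cell k u & (g u <= ess_sup mu g)%E.
    apply: contrapT => hn; have := ess_sup_ge mu g => -[N [mN N0 sN]].
    have : (mu (cell k) <= mu N)%E.
      apply: le_measure.
      - by rewrite inE; exact: measurable_cell.
      - by rewrite inE.
      by move=> u cu; apply: sN => /= gu; apply: hn; exists u.
    by rewrite N0 leNgt mu_cell_gt0.
  apply: ge_ereal_sup => _ [k _ <-].
  have [u cu gu] := ae_ex k; apply: le_trans gu.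
  rewrite ge_max g0/=; have [xk0|xk0] := leP (x k) 0%E; first exact: le_trans (g0 u).
  move/cellP: cu => [u0 uk].
  have [|Du xhu] := xh u u0; first by rewrite uk.
  rewrite uk in xhu; apply: (le_trans xhu).
  rewrite /g/= /patch mem_set// rinvy oppr0 powRr0 mul1e gee0_abs//.
  by have [] := Dh u Du.
(* Now a lower bound for the Haar measure of a cell: its length times [1 / epoint (k + 1)], the
   infimum of [1/u] on it. *)
pose c := (1 - expR (- 1)) : R.
have c0 : 0 < c by rewrite subr_gt0 -expR0 ltr_expR oppr_lt0.
exists (c^-1 `^ r^-1); first by rewrite powR_gt0// invr_gt0.
move=> D h x Dh xh; rewrite /haar_norm /Lq_norm qE unlock /=.
rewrite -poweR_EFin -poweRM ?lee_fin ?invr_ge0 ?(ltW c0)//; last first.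
  by apply: integral_ge0 => u _; exact: poweR_ge0.
apply: poweR_le; first by rewrite invr_ge0 ltW.
  by apply: esum_ge0 => k _; exact: poweR_ge0.
pose y k := ((epoint (k + 1) : R)^-1%:E * (maxe 0 (x k)) `^ r)%E.
have y0 k : (0 <= y k)%E.
  by rewrite mule_ge0 ?poweR_ge0// lee_fin invr_ge0 ltW// epoint_gt0.
apply: (@le_trans _ _ (c^-1%:E *
    \esum_(k in [set: int]) (((expR 1 - 1) * epoint k)%:E * y k))%E).
  have -> : (\esum_(k in [set: int]) (((expR 1 - 1) * epoint k)%:E * y k) =
      \esum_(k in [set: int]) (c%:E * (maxe 0 (x k)) `^ r))%E.
    apply: eq_esum => k _; rewrite /y muleA -EFinM; congr (_%:E * _)%E.
    rewrite /c epointD1 expRN; field.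
    by rewrite !gt_eqF ?expR_gt0 ?epoint_gt0.
  have -> : (\esum_(k in [set: int]) (maxe 0 (x k)) `^ r =
     \esum_(k in [set: int]) (c^-1%:E * (c%:E * (maxe 0 (x k)) `^ r)))%E.
    by apply: eq_esum => k _; rewrite muleA -EFinM mulVf ?gt_eqF// mul1e.
  apply: esumZ_le; first by rewrite invr_ge0 ltW.
  by move=> k; rewrite mule_ge0 ?poweR_ge0// lee_fin ltW.
rewrite lee_wpmul2l ?lee_fin ?invr_ge0 ?(ltW c0)//.
rewrite -integral_log_stepT//; apply: le_lower_integral => u.
  by rewrite /patch; case: ifP.
rewrite poweR_patch//; last by move=> /Dh[].
rewrite {1}/patch; case: ifPn => [|_]; last first.
  case: ifPn => //; rewrite inE => /Dh[u0 h0].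
  by rewrite mule_ge0 ?poweR_ge0// lee_fin invr_ge0 ltW.
rewrite inE/= in_itv/= andbT => u0.
have [xk0|xk0] := leP (x (log_floor u)) 0%E.
  rewrite /y (max_idPl xk0) poweR0r ?gt_eqF// mule0; case: ifPn => //.
  by rewrite inE => /Dh[_ h0]; rewrite mule_ge0 ?poweR_ge0// lee_fin invr_ge0 ltW.
have [Du xhu] := xh u u0 xk0; rewrite mem_set//.
have /andP[_ fu] := log_floor_itv _ u0.
apply: lee_pmul.
- by rewrite lee_fin invr_ge0 ltW// epoint_gt0.
- exact: poweR_ge0.
- by rewrite lee_fin lef_pV2 ?posrE ?epoint_gt0// ltW.
- apply: poweR_le; rewrite ?(ltW r0) ?maxe0_ge0//.
  by rewrite ge_max xhu andbT; exact: le_trans (ltW xk0) xhu.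
Qed.

End discretization.

(** ** Functions that vary slowly on the scale of the discretization *)

(** Comparability over one unit of the logarithmic scale, two-sided because [s] and [t] can be
    exchanged. Weights, K-functionals and inner norms all satisfy it. *)
Definition doubling (R : realType) (A : R) (h : R -> \bar R) : Prop :=
  forall s t, 0 < s -> 0 < t -> `|ln s - ln t| <= 1 ->
  (0 <= h s /\ h s <= A%:E * h t)%E.
Arguments doubling {R} A h.

Definition keep (R : realType) (P : pred int) (x : int -> \bar R) (j : int)
    : \bar R := if P j then x j else 0%E.
Arguments keep {R} P x j.

Section doubling.
Context {R : realType}.
Local Open Scope ereal_scope.
Implicit Types (h : R -> \bar R) (x : int -> \bar R) (P : pred int).

Lemma le_mul_trans (a b c : \bar R) (C D : R) : (0 <= C)%R ->
  a <= C%:E * b -> b <= D%:E * c -> a <= (C * D)%:E * c.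
Proof.
move=> C0 ab bc; apply: (le_trans ab); rewrite EFinM -muleA.
by rewrite lee_wpmul2l ?lee_fin.
Qed.

Lemma doubling_ge0 A h u : doubling A h -> (0 < u)%R -> 0 <= h u.
Proof. by move=> hh u0; have [] := hh u u u0 u0 _; rewrite ?subrr ?normr0 ?ler01. Qed.

Lemma le_log_floor (u v : R) : (0 < u)%R -> (u <= v)%R ->
  (log_floor u <= log_floor v)%R.
Proof.
move=> u0 uv; apply: le_floor; rewrite ler_ln ?posrE//; exact: lt_le_trans uv.
Qed.

Lemma log_floor_dist (u : R) : (0 < u)%R ->
  (`|ln u - ln (epoint (log_floor u) : R)| <= 1)%R.
Proof.
move=> u0; rewrite ln_epoint /log_floor ger0_norm ?subr_ge0 ?floor_le//.
have := floorD1_gt (ln u); rewrite intrD => /ltW; lra.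
Qed.

Lemma epoint_dist j k :
  (`|ln (epoint j : R) - ln (epoint k)| = `|(j - k)%:~R|)%R.
Proof. by rewrite !ln_epoint intrD rmorphN. Qed.

Lemma log_floor_near (s t : R) : (`|ln s - ln t| <= 1)%R ->
  (log_floor s <= log_floor t + 1)%R.
Proof.
rewrite ler_norml => /andP[_ st]; rewrite -ltzD1 /log_floor floor_lt_int !intrD.
have := floorD1_gt (ln t); rewrite intrD; lra.
Qed.

Lemma doubling_epointS A h k l : doubling A h -> (`|k - l| <= 1)%R ->
  h (epoint k) <= A%:E * h (epoint l).
Proof.
move=> hh kl; have [|//] := hh (epoint k) (epoint l) (epoint_gt0 _) (epoint_gt0 _).
by rewrite epoint_dist -intr_norm (ler_int _ _ 1%R).
Qed.

Lemma doubling_epoint A h u : doubling A h -> (0 < u)%R ->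
  h u <= A%:E * h (epoint (log_floor u)) /\
  h (epoint (log_floor u)) <= A%:E * h u.
Proof.
move=> hh u0; have d := log_floor_dist u u0.
split; first by have [] := hh u _ u0 (epoint_gt0 _) d.
by rewrite distrC in d; have [] := hh _ u (epoint_gt0 _) u0 d.
Qed.

(** The two bounds have different conditions because the boundary of [D] may cut a cell: the cells
    in [P] must cover [D] for the upper bound and lie inside [D] for the lower one. *)
Lemma haar_norm_discrete q (A : R) : 0 < q -> (0 < A)%R ->
  exists2 C : R, (0 < C)%R & forall (D : set R) P h, doubling A h ->
  ((forall u, D u -> (0 < u)%R /\ P (log_floor u)) ->
    haar_norm q D h <= C%:E * lq q (keep P (h \o epoint))) /\
  ((forall u, D u -> (0 < u)%R) ->
   (forall u, (0 < u)%R -> P (log_floor u) -> D u) ->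
    lq q (keep P (h \o epoint)) <= C%:E * haar_norm q D h).
Proof.
move=> q0 A0; have [C1 C10 h1] := haar_norm_le_lq q q0.
have [C2 C20 h2] := lq_le_haar_norm q q0.
have key (C : R) (a b : \bar R) : (C <= C1 * A + A * C2)%R -> 0 <= b ->
    a <= C%:E * b -> a <= (C1 * A + A * C2)%:E * b.
  by move=> CC b0 ab; apply: (le_trans ab); rewrite lee_wpmul2r// lee_fin.
exists (C1 * A + A * C2)%R; first by rewrite addr_gt0// mulr_gt0.
move=> D P h hh; have h0 u := doubling_ge0 A h u hh; split.
  move=> DP; apply: (key (C1 * A)%R).
  - by rewrite lerDl mulr_ge0// ltW.
  - exact: lq_ge0.
  apply: le_mul_trans; first exact: (ltW C10).
    apply: (h1 _ _ (fun j => A%:E * keep P (h \o epoint) j)).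
    move=> u Du; have [u0 Pu] := DP u Du; split=> //; split; first exact: h0.
    by rewrite /keep Pu; have [] := doubling_epoint A h u hh u0.
  by apply: lq_scale => //; exact: ltW.
move=> Dpos PD; apply: (key (A * C2)%R).
- by rewrite lerDr mulr_ge0 ?ltW.
- exact: Lnorm_ge0.
apply: (@le_mul_trans _ (lq q (fun j => A^-1%:E * keep P (h \o epoint) j))).
- exact: ltW.
- apply: le_trans (lq_scale _ _ _ q0 (ltW A0)); apply: lq_le => // k.
  by rewrite muleA -EFinM divff ?gt_eqF// mul1e.
apply: h2 => [u Du|u u0]; first by have u0 := Dpos u Du; split=> //; exact: h0.
rewrite /keep; case: ifPn => [Pu _|_]; last by rewrite mule0 ltxx.
split; first exact: PD.
have [_ hA] := doubling_epoint A h u hh u0.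
by rewrite /= lee_pdivrMl.
Qed.

Lemma lq_single q : 0 < q -> exists2 C : R, (0 < C)%R & forall x k,
  0 <= x k -> lq q (keep (pred1 k) x) <= C%:E * x k.
Proof.
move=> q0; have [C C0 hC] := lq_geo q 1 q0 ltr01; exists C => // x k xk0.
apply: (hC _ k) => // j; rewrite /keep /=; case: eqP => [->|_].
  by rewrite subrr normr0 mulr0 oppr0 expR0 mul1e.
by rewrite mule_ge0// lee_fin expR_ge0.
Qed.

(** Restores a cell [k] that was cut by an endpoint: its value is paid for by a neighbour [l] that
    was kept. *)
Lemma lq_keep_adjoin q (A : R) : 0 < q -> (0 < A)%R ->
  exists2 C : R, (0 < C)%R & forall P P' x (k l : int), (forall j, 0 <= x j) ->
  P' l -> x k <= A%:E * x l -> (forall j, P j -> P' j || (j == k)) ->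
  lq q (keep P x) <= C%:E * lq q (keep P' x).
Proof.
move=> q0 A0; have [C1 C10 h1] := lq_add q q0; have [C2 C20 h2] := lq_single q q0.
exists (C1 * (1 + C2 * A))%R.
  by rewrite mulr_gt0// addr_gt0// mulr_gt0.
move=> P P' x k l x0 P'l xkl PP'.
apply: (@le_mul_trans _ (lq q (keep P' x) + lq q (keep (pred1 k) x))).
- exact: ltW.
- apply: le_trans (h1 _ _); apply: lq_le => // j; rewrite /keep/=.
  case: ifPn => [/PP'|_].
    by case: ifPn => /= _; [|move=> ->]; rewrite ?add0e// leeDl//; case: ifP.
  by rewrite adde_ge0//; case: ifP.
rewrite EFinD ge0_muleDl ?lee_fin ?mulr_ge0 ?(ltW C20) ?(ltW A0)// mul1e.
apply: leeD => //; apply: le_mul_trans (h2 _ _ _) _; rewrite ?(ltW C20)//.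
apply: (le_trans xkl); rewrite lee_wpmul2l ?lee_fin ?(ltW A0)//.
by have := lq_point q (keep P' x) l q0; rewrite {1}/keep P'l.
Qed.

Lemma haar_norm_line q (A : R) : 0 < q -> (0 < A)%R ->
  exists2 C : R, (0 < C)%R & forall h, doubling A h ->
  haar_norm q `]0%R, +oo[ h <= C%:E * lq q (h \o epoint) /\
  lq q (h \o epoint) <= C%:E * haar_norm q `]0%R, +oo[ h.
Proof.
move=> q0 A0; have [C C0 hC] := haar_norm_discrete q A q0 A0.
exists C => // h hh; have [h1 h2] := hC `]0%R, +oo[%classic predT h hh.
have e : keep predT (h \o epoint) = h \o epoint by apply/funext.
rewrite e in h1 h2; split; [apply: h1|apply: h2] => u/=;
  by rewrite ?in_itv/= ?andbT.
Qed.

Lemma haar_norm_left q (A : R) : 0 < q -> (0 < A)%R ->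
  exists2 C : R, (0 < C)%R & forall h, doubling A h -> forall s, (0 < s)%R ->
  haar_norm q `]0%R, s[ h <=
    C%:E * lq q (keep (fun j => (j <= log_floor s)%R) (h \o epoint)) /\
  lq q (keep (fun j => (j <= log_floor s)%R) (h \o epoint)) <=
    C%:E * haar_norm q `]0%R, s[ h.
Proof.
move=> q0 A0; have [C C0 hC] := haar_norm_discrete q A q0 A0.
have [C' C'0 hC'] := lq_keep_adjoin q A q0 A0.
exists (C + C' * C)%R; first by rewrite addr_gt0// mulr_gt0.
move=> h hh s s0; have h0 j : 0 <= (h \o epoint) j.
  by apply: doubling_ge0; [exact: hh|exact: epoint_gt0].
split.
  have [h1 _] := hC `]0%R, s[%classic (fun j => (j <= log_floor s)%R) h hh.
  apply: le_trans (h1 _) _.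
    by move=> u/=; rewrite in_itv/= => /andP[u0 us]; rewrite u0 le_log_floor// ltW.
  by rewrite lee_wpmul2r ?lq_ge0// lee_fin lerDl mulr_ge0 ?ltW.
(* The cell of [s] sticks out beyond [s], hence the strict inequality; it is adjoined afterwards
   through its left neighbour. *)
have [_ h2] := hC `]0%R, s[%classic (fun j => (j < log_floor s)%R) h hh.
apply: (@le_trans _ _ ((C' * C)%:E * haar_norm q `]0%R, s[ h)); last first.
  by rewrite lee_wpmul2r ?Lnorm_ge0// lee_fin lerDr ltW.
apply: le_mul_trans (h2 _ _); first exact: ltW.
- apply: (hC' _ _ _ (log_floor s) (log_floor s - 1)%R) => //=.
  + by lia.
  + by apply: (doubling_epointS _ _ _ _ hh); lia.
  + by move=> j; lia.
- by move=> u /=; rewrite in_itv/= => /andP[].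
- move=> u u0 us; rewrite /= in_itv/= u0/= ltNge; apply/negP => su.
  by have := le_log_floor _ _ s0 su; lia.
Qed.


Lemma haar_norm_right q (A : R) : 0 < q -> (0 < A)%R ->
  exists2 C : R, (0 < C)%R & forall h, doubling A h -> forall s, (0 < s)%R ->
  haar_norm q `]s, +oo[ h <=
    C%:E * lq q (keep (fun j => (log_floor s <= j)%R) (h \o epoint)) /\
  lq q (keep (fun j => (log_floor s <= j)%R) (h \o epoint)) <=
    C%:E * haar_norm q `]s, +oo[ h.
Proof.
move=> q0 A0; have [C C0 hC] := haar_norm_discrete q A q0 A0.
have [C' C'0 hC'] := lq_keep_adjoin q A q0 A0.
exists (C + C' * C)%R; first by rewrite addr_gt0// mulr_gt0.
move=> h hh s s0; have h0 j : 0 <= (h \o epoint) j.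
  by apply: doubling_ge0; [exact: hh|exact: epoint_gt0].
split.
  have [h1 _] := hC `]s, +oo[%classic (fun j => (log_floor s <= j)%R) h hh.
  apply: le_trans (h1 _) _.
    move=> u/=; rewrite in_itv/= andbT => us; rewrite (lt_trans s0 us).
    by rewrite le_log_floor// ltW.
  by rewrite lee_wpmul2r ?lq_ge0// lee_fin lerDl mulr_ge0 ?ltW.
(* The cell of [s] starts at or before [s]; it is adjoined through its right neighbour. *)
have [_ h2] := hC `]s, +oo[%classic (fun j => (log_floor s < j)%R) h hh.
apply: (@le_trans _ _ ((C' * C)%:E * haar_norm q `]s, +oo[ h)); last first.
  by rewrite lee_wpmul2r ?Lnorm_ge0// lee_fin lerDr ltW.
apply: le_mul_trans (h2 _ _); first exact: ltW.
- apply: (hC' _ _ _ (log_floor s) (log_floor s + 1)%R) => //=.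
  + by lia.
  + by apply: (doubling_epointS _ _ _ _ hh); lia.
  + by move=> j; lia.
- by move=> u /=; rewrite in_itv/= andbT; exact: lt_trans.
- move=> u u0 us; rewrite /= in_itv/= andbT ltNge; apply/negP => su.
  by have := le_log_floor _ _ u0 su; lia.
Qed.

(** Moving the endpoint by one logarithmic unit adds at most one cell. Hence an inner norm may
    itself be the integrand of an outer norm that is to be discretized. *)
Lemma doubling_haar_norm_left q (A : R) : 0 < q -> (0 < A)%R ->
  exists2 B : R, (0 < B)%R & forall h, doubling A h ->
  doubling B (fun s => haar_norm q `]0%R, s[ h).
Proof.
move=> q0 A0; have [C C0 hC] := haar_norm_left q A q0 A0.
have [C' C'0 hC'] := lq_keep_adjoin q A q0 A0.
exists (C * (C' * C))%R; first by rewrite !mulr_gt0.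
move=> h hh s t s0 t0 st; split; first exact: Lnorm_ge0.
apply: le_mul_trans (proj1 (hC h hh s s0)) _; first exact: ltW.
apply: le_mul_trans _ (proj2 (hC h hh t t0)); first exact: ltW.
apply: (hC' _ _ _ (log_floor t + 1)%R (log_floor t)) => //=.
- by move=> j; apply: doubling_ge0; [exact: hh|exact: epoint_gt0].
- by apply: (doubling_epointS _ _ _ _ hh); lia.
- by move=> j; have := log_floor_near _ _ st; lia.
Qed.

Lemma doubling_haar_norm_right q (A : R) : 0 < q -> (0 < A)%R ->
  exists2 B : R, (0 < B)%R & forall h, doubling A h ->
  doubling B (fun s => haar_norm q `]s, +oo[ h).
Proof.
move=> q0 A0; have [C C0 hC] := haar_norm_right q A q0 A0.
have [C' C'0 hC'] := lq_keep_adjoin q A q0 A0.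
exists (C * (C' * C))%R; first by rewrite !mulr_gt0.
move=> h hh s t s0 t0 st; split; first exact: Lnorm_ge0.
apply: le_mul_trans (proj1 (hC h hh s s0)) _; first exact: ltW.
apply: le_mul_trans _ (proj2 (hC h hh t t0)); first exact: ltW.
apply: (hC' _ _ _ (log_floor t - 1)%R (log_floor t)) => //=.
- by move=> j; apply: doubling_ge0; [exact: hh|exact: epoint_gt0].
- by apply: (doubling_epointS _ _ _ _ hh); lia.
- by move=> j; rewrite distrC in st; have := log_floor_near _ _ st; lia.
Qed.

Lemma doublingM (A B : R) (g : R -> R) h : (0 < A)%R -> (0 < B)%R ->
  doubling A (EFin \o g) -> doubling B h ->
  doubling (A * B) (fun u => (g u)%:E * h u).
Proof.
move=> A0 B0 hg hh s t s0 t0 st.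
have [g0 gs] := hg s t s0 t0 st; have [h0 hs] := hh s t s0 t0 st.
split; first exact: mule_ge0.
by rewrite EFinM muleACA; apply: lee_pmul.
Qed.

End doubling.

(** ** Potter bounds *)

(** Potter's inequality [v(s)/v(t) <= C (s/t)^alpha max(s/t, t/s)^e], taken as the definition of
    regular variation of index [alpha]. Exchanging [s] and [t] gives the matching lower bound. *)
Definition regvar (R : realType) (alpha : R) (v : R -> R) : Prop :=
  (forall t, 0 < t -> 0 < v t) /\
  forall e, 0 < e -> exists2 C, 0 < C & forall s t, 0 < s -> 0 < t ->
    v s <= C * expR (alpha * (ln s - ln t) + e * `|ln s - ln t|) * v t.
Arguments regvar {R} alpha v.

Section regvar.
Context {R : realType}.
Implicit Types (v w : R -> R) (alpha beta : R).

Lemma regvar_powR alpha : regvar alpha (fun t => t `^ alpha).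
Proof.
split=> [t|e e0]; first exact: powR_gt0.
exists 1 => // s t s0 t0; rewrite mul1r /powR !gt_eqF// -expRD ler_expR.
have := normr_ge0 (ln s - ln t); nra.
Qed.

Lemma regvarM alpha beta v w : regvar alpha v -> regvar beta w ->
  regvar (alpha + beta) (fun t => v t * w t).
Proof.
move=> [v0 hv] [w0 hw]; split=> [t t0|e e0]; first by rewrite mulr_gt0 ?v0 ?w0.
have e2 : 0 < e / 2 by rewrite divr_gt0.
have [C C0 hC] := hv _ e2; have [D D0 hD] := hw _ e2.
exists (C * D); first exact: mulr_gt0.
move=> s t s0 t0.
have -> : (alpha + beta) * (ln s - ln t) + e * `|ln s - ln t| =
  (alpha * (ln s - ln t) + e / 2 * `|ln s - ln t|) +
  (beta * (ln s - ln t) + e / 2 * `|ln s - ln t|) by field.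
rewrite expRD; apply: (le_trans (ler_pM _ _ (hC s t s0 t0) (hD s t s0 t0))).
- exact/ltW/v0.
- exact/ltW/w0.
- by rewrite le_eqVlt; apply/orP; left; apply/eqP; ring.
Qed.

Lemma regvarV alpha v : regvar alpha v -> regvar (- alpha) (fun t => (v t)^-1).
Proof.
move=> [v0 hv]; split=> [t t0|e e0]; first by rewrite invr_gt0 v0.
have [C C0 hC] := hv _ e0; exists C => // s t s0 t0.
rewrite ler_pdivlMr ?v0// mulrC ler_pdivrMr ?v0//; apply: (le_trans (hC t s t0 s0)).
by rewrite distrC mulNr -mulrN opprB.
Qed.

Lemma regvar_pow alpha v p : 0 < p -> regvar alpha v ->
  regvar (alpha * p) (fun t => v t `^ p).
Proof.
move=> p0 [v0 hv]; split=> [t t0|e e0]; first exact/powR_gt0/v0.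
have [C C0 hC] := hv (e / p) (divr_gt0 e0 p0).
exists (C `^ p); first exact: powR_gt0.
move=> s t s0 t0.
have -> : alpha * p * (ln s - ln t) + e * `|ln s - ln t| =
  (alpha * (ln s - ln t) + e / p * `|ln s - ln t|) * p by field; rewrite gt_eqF.
rewrite expRM -!powRM ?mulr_ge0 ?expR_ge0 ?(ltW C0) ?(ltW (v0 _ _))//.
by rewrite ge0_ler_powR ?nnegrE ?(ltW p0) ?mulr_ge0 ?expR_ge0 ?(ltW C0) ?(ltW (v0 _ _))// hC.
Qed.

Lemma eq_regvar alpha beta v w : (forall t, 0 < t -> v t = w t) ->
  alpha = beta -> regvar alpha v -> regvar beta w.
Proof.
move=> vw <- [v0 hv]; split=> [t t0|e e0]; first by rewrite -vw// v0.
by have [C C0 hC] := hv e e0; exists C => // s t s0 t0; rewrite -!vw//; exact: hC.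
Qed.

Lemma equivalent_regvar alpha v w : (forall t, 0 < t -> 0 < v t) ->
  equivalent v w -> regvar alpha w -> regvar alpha v.
Proof.
move=> v0 [D D0 vw] [w0 hw]; split=> // e e0.
have [C C0 hC] := hw e e0; exists (D * C * D); first by rewrite !mulr_gt0.
move=> s t s0 t0; have [h1 _] := vw s s0; have [_ h2] := vw t t0.
apply: (le_trans h1); rewrite -!mulrA ler_pM2l//.
apply: (le_trans (hC s t s0 t0)); rewrite -mulrA ler_pM2l// mulrCA ler_pM2l ?expR_gt0//.
Qed.

(** For [s <= t] the bound comes from [t^e b(t)] being almost increasing, for [s >= t] from
    [t^(-e) b(t)] being almost decreasing; the two cases are the two signs of [ln s - ln t]. *)
Lemma slowly_varying_regvar (b : R -> R) : slowly_varying b -> regvar 0 b.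
Proof.
move=> [[_ b0] hb]; split=> // e e0.
have [[g g_inc [C C0 hC]] [g' g'_dec [C' C'0 hC']]] := hb e e0.
have bd (D : R) (x y z w : R) : 0 < D -> x <= D * y -> y <= z -> z <= D * w ->
    x <= D * D * w.
  by move=> D0 xy yz zw; apply: (le_trans xy); rewrite -mulrA ler_pM2l// (le_trans yz).
exists (C * C + C' * C'); first by rewrite addr_gt0// mulr_gt0.
move=> s t s0 t0; rewrite mul0r add0r.
pose F d := d * expR (e * `|ln s - ln t|) * b t.
have mono d : d <= C * C + C' * C' -> F d <= F (C * C + C' * C').
  by move=> dC; rewrite /F ler_wpM2r ?(ltW (b0 _ t0))// ler_wpM2r ?expR_ge0.
have in0 (x : R) : 0 < x -> x \in `]0, +oo[ by move=> x0; rewrite in_itv/= x0.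
have [st|/ltW ts] := leP s t.
  apply: le_trans (mono (C * C) _); last by rewrite lerDl mulr_ge0 ?ltW.
  have [h1 _] := hC s s0; have [_ h2] := hC t t0.
  have := bd C _ _ _ _ C0 h1 (g_inc _ _ (in0 _ s0) (in0 _ t0) st) h2.
  rewrite /F /powR !gt_eqF// distrC ger0_norm ?subr_ge0 ?ler_ln ?posrE//.
  rewrite mulrBr expRD expRN => h.
  rewrite -(ler_pM2l (expR_gt0 (e * ln s))); apply: (le_trans h).
  rewrite le_eqVlt; apply/orP; left; apply/eqP; field.
  by rewrite gt_eqF ?expR_gt0.
apply: le_trans (mono (C' * C') _); last by rewrite lerDr mulr_ge0 ?ltW.
have [h1 _] := hC' s s0; have [_ h2] := hC' t t0.
have := bd C' _ _ _ _ C'0 h1 (g'_dec _ _ (in0 _ s0) (in0 _ t0) ts) h2.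
rewrite /F /powR !gt_eqF// ger0_norm ?subr_ge0 ?ler_ln ?posrE//.
rewrite mulrBr expRD => h.
rewrite -(ler_pM2l (expR_gt0 (- e * ln s))); apply: (le_trans h).
rewrite !mulNr !expRN le_eqVlt; apply/orP; left; apply/eqP; field.
by rewrite !gt_eqF ?expR_gt0.
Qed.

Lemma regvar_doubling alpha v : regvar alpha v ->
  exists2 A, 0 < A & doubling A (EFin \o v).
Proof.
move=> [v0 hv]; have [C C0 hC] := hv 1 ltr01.
exists (C * expR (`|alpha| + 1)); first by rewrite mulr_gt0 ?expR_gt0.
move=> s t s0 t0 st; rewrite /= lee_fin (ltW (v0 _ _))// -EFinM lee_fin; split=> //.
apply: (le_trans (hC s t s0 t0)); rewrite ler_pM2r ?v0// ler_pM2l// ler_expR.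
apply: lerD; last by rewrite mul1r.
by apply: (le_trans (ler_norm _)); rewrite normrM ler_piMr.
Qed.

Lemma regvar_ln alpha v : regvar alpha v -> forall e, 0 < e ->
  exists c, forall s t, 0 < s -> 0 < t ->
  `|ln (v s) - ln (v t) - alpha * (ln s - ln t)| <= c + e * `|ln s - ln t|.
Proof.
move=> [v0 hv] e e0; have [C C0 hC] := hv e e0; exists (ln C) => s t s0 t0.
have key x y : 0 < x -> 0 < y ->
    ln (v x) <= ln C + (alpha * (ln x - ln y) + e * `|ln x - ln y|) + ln (v y).
  move=> x0 y0; have := hC x y x0 y0; set z := alpha * _ + _.
  have vx0 := v0 x x0; have vy0 := v0 y y0; have z0 := expR_gt0 z.
  by rewrite -ler_ln ?posrE ?mulr_gt0// lnM ?posrE ?mulr_gt0// lnM ?posrE// expRK.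
have h1 := key s t s0 t0; have := key t s t0 s0; rewrite [`|ln t - _|]distrC => h2.
rewrite ler_norml; apply/andP; split; lra.
Qed.

Lemma regvar_comp alpha (a : R -> R) v : regvar 0 a -> regvar alpha v ->
  regvar 0 (fun t => a (v t)).
Proof.
move=> [a0 ha] hv; have v0 := proj1 hv; split=> [t t0|e e0]; first exact/a0/v0.
have [c hc] := regvar_ln _ _ hv 1 ltr01.
(* By [regvar_ln] with tolerance [1], [ln v] changes by at most [c + N |ln s - ln t|], so the
   exponent used for [a] has to be [N] times smaller. *)
pose N := `|alpha| + 1; have N0 : 0 < N by rewrite ltr_wpDl.
have [C C0 hC] := ha (e / N) (divr_gt0 e0 N0).
exists (C * expR (e / N * c)); first by rewrite mulr_gt0 ?expR_gt0.
move=> s t s0 t0; rewrite mul0r add0r.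
apply: (le_trans (hC _ _ (v0 s s0) (v0 t t0))).
rewrite ler_pM2r ?a0 ?v0// -[leRHS]mulrA ler_pM2l// mul0r add0r -expRD ler_expR.
have -> : e / N * c + e * `|ln s - ln t| = e / N * (c + N * `|ln s - ln t|).
  by field; rewrite gt_eqF.
rewrite ler_pM2l ?divr_gt0//; have h := hc s t s0 t0.
have -> : ln (v s) - ln (v t) = alpha * (ln s - ln t) +
  (ln (v s) - ln (v t) - alpha * (ln s - ln t)) by ring.
apply: (le_trans (ler_normD _ _)); rewrite normrM.
by rewrite /N mulrDl mul1r addrCA lerD2l; rewrite mul1r in h.
Qed.

Lemma regvar_epoint alpha v : regvar alpha v -> forall e, 0 < e ->
  exists2 C, 0 < C & forall j k : int,
    v (epoint j) <=
      C * expR (alpha * (j - k)%:~R + e * `|(j - k)%:~R|) * v (epoint k).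
Proof.
move=> [_ hv] e e0; have [C C0 hC] := hv e e0; exists C => // j k.
have := hC _ _ (epoint_gt0 j) (epoint_gt0 k).
by rewrite !ln_epoint -rmorphN -intrD.
Qed.

End regvar.

(** * Primitives of slowly varying weights *)

Section primitive.
Context {R : realType}.
Local Open Scope ereal_scope.
Implicit Types (w : R -> R).

(** A longer interval adds cells [k < j <= m] on which [w] is at most of order
    [e^(e (j - k)) w(e^k)]. The value [w(e^k)] is already a term of the norm over [(0, t)], and the
    geometric sum is of the size of its last term [j = m]. *)
Lemma haar_norm_left_growth q w (e : R) : 0 < q -> regvar 0 w -> (0 < e)%R ->
  exists2 C : R, (0 < C)%R & forall s t, (0 < s)%R -> (0 < t)%R ->
  haar_norm q `]0%R, s[ (EFin \o w) <=
    (C * expR (e * `|ln s - ln t|))%:E * haar_norm q `]0%R, t[ (EFin \o w).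
Proof.
move=> q0 hw e0; have [A A0 hA] := regvar_doubling _ _ hw.
have [C C0 hC] := haar_norm_left q A q0 A0.
have [D D0 hD] := lq_add q q0; have [G G0 hG] := lq_geo q e q0 e0.
have [P P0 hP] := regvar_epoint _ _ hw e e0.
pose B := (C * (D * (1 + G * P * expR e)) * C)%R.
exists B.
  by rewrite !mulr_gt0// addr_gt0// !mulr_gt0// expR_gt0.
move=> s t s0 t0; set k := log_floor t; set m := log_floor s.
have w0 j : (0 < w (epoint j))%R by apply: (proj1 hw); exact: epoint_gt0.
set E := expR (e * `|ln s - ln t|)%R.
have E1 : (1 <= E)%R by rewrite -expR0 ler_expR mulr_ge0// ltW.
have [h1 _] := hC _ hA s s0; have [_ h2] := hC _ hA t t0.
set x := EFin \o w \o epoint in h1 h2.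
have -> : (B * E = C * (D * (1 + G * P * expR e) * E) * C)%R by rewrite /B; ring.
apply: le_mul_trans _ h2; first by rewrite !mulr_ge0 ?expR_ge0
  ?addr_ge0 ?mulr_ge0 ?expR_ge0 ?(ltW C0) ?(ltW D0) ?(ltW G0) ?(ltW P0).
apply: le_mul_trans h1 _; first exact: ltW.
pose y j : \bar R := if (k < j <= m)%R then x j else 0.
apply: (@le_trans _ _ (D%:E * (lq q (keep (fun j => (j <= k)%R) x) + lq q y))).
  apply: le_trans (hD _ _); apply: lq_le => // j; rewrite /keep /y.
  by case: (leP j k) => jk; case: (leP j m) => jm /=; rewrite ?adde0 ?add0e// lee_fin ltW.
set L := lq q (keep _ _).
have hL : (w (epoint k))%:E <= L.
  by have := lq_point q (keep (fun j => (j <= k)%R) x) k q0; rewrite {1}/keep lexx.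
have L0 : 0 <= L by exact: lq_ge0.
have hy : lq q y <= (G * P * expR e * E)%:E * L.
  have -> : (G * P * expR e * E = G * (P * expR e * E))%R by ring.
  apply: (le_mul_trans _ (((P * expR e * E) * w (epoint k))%:E)) => //; first exact: ltW.
    apply: (hG _ m); first by rewrite lee_fin !mulr_ge0 ?expR_ge0 ?(ltW P0)// ltW.
    move=> j; rewrite /y; case: ifPn => [/andP[kj jm]|_]; last first.
      by rewrite mule_ge0 ?lee_fin ?expR_ge0// !mulr_ge0 ?expR_ge0 ?(ltW P0)// ltW.
    rewrite /x /= -EFinM lee_fin; apply: (le_trans (hP j k)).
    (* Rounding both endpoints costs one unit, which is the factor [expR e] in [B]. *)
    have mk : ((m - k)%:~R <= 1 + `|ln s - ln t|)%R.
      have := ler_norm (ln s - ln t)%R; have := floor_le (ln s); have := floorD1_gt (ln t).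
      by rewrite -/(log_floor t) -/(log_floor s) -/k -/m !intrD rmorphN /=; lra.
    have djk : (`|(j - k)%:~R| = (j - k)%:~R :> R)%R.
      by rewrite ger0_norm// ler0z subr_ge0 ltW.
    have djm : (`|(j - m)%:~R| = (m - j)%:~R :> R)%R.
      by rewrite -normrN -rmorphN opprB ger0_norm// ler0z subr_ge0.
    have key : (expR (e * `|(j - k)%:~R|) <=
        expR (- (e * `|(j - m)%:~R|)) * (expR e * E))%R.
      rewrite /E -!expRD ler_expR djk djm.
      have : (e * ((j - k)%:~R + (m - j)%:~R) <= e * (1 + `|ln s - ln t|))%R.
        by rewrite ler_pM2l// -intrD (_ : j - k + (m - j) = m - k)%R//; ring.
      by lra.
    apply: (@le_trans _ _ (P * (expR (- (e * `|(j - m)%:~R|)) * (expR e * E)) *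
        w (epoint k))%R); first by rewrite ler_pM2r// ler_pM2l// mul0r add0r.
    by rewrite le_eqVlt; apply/orP; left; apply/eqP; ring.
  by rewrite EFinM lee_wpmul2l// lee_fin !mulr_ge0 ?expR_ge0 ?(ltW P0).
rewrite -(mulrA D) EFinM -muleA; apply: lee_wpmul2l; first by rewrite lee_fin ltW.
rewrite mulrDl mul1r EFinD ge0_muleDl ?lee_fin ?mulr_ge0 ?expR_ge0 ?(ltW G0) ?(ltW P0)//.
apply: leeD => //.
by rewrite -[leLHS]mul1e lee_wpmul2r// lee_fin.
Qed.

Lemma haar_norm_left_ge q w : 0 < q -> regvar 0 w ->
  exists2 C : R, (0 < C)%R & forall s, (0 < s)%R ->
  (w (epoint (log_floor s)))%:E <= C%:E * haar_norm q `]0%R, s[ (EFin \o w).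
Proof.
move=> q0 hw; have [A A0 hA] := regvar_doubling _ _ hw.
have [C C0 hC] := haar_norm_left q A q0 A0; exists C => // s s0.
apply: le_trans (proj2 (hC _ hA s s0)).
have := lq_point q (keep (fun j => (j <= log_floor s)%R) (EFin \o w \o epoint))
  (log_floor s) q0.
by rewrite {1}/keep lexx.
Qed.

Lemma regvar_haar_norm_left q w : 0 < q -> regvar 0 w ->
  haar_norm q `]0%R, 1%R[ (EFin \o w) < +oo ->
  (forall s, (0 < s)%R -> (fine (haar_norm q `]0%R, s[ (EFin \o w)))%:E =
    haar_norm q `]0%R, s[ (EFin \o w)) /\
  regvar 0 (fun s => fine (haar_norm q `]0%R, s[ (EFin \o w))).
Proof.
move=> q0 hw fin1; set W := fun s => haar_norm q `]0%R, s[ (EFin \o w).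
have W0 s : 0 <= W s by exact: Lnorm_ge0.
have Wfin s : (0 < s)%R -> W s \is a fin_num.
  move=> s0; rewrite ge0_fin_numE//.
  (* The growth bound with [t = 1] spreads finiteness from [(0, 1)] to every [(0, s)]. *)
  have [C C0 hC] := haar_norm_left_growth q w 1 q0 hw ltr01.
  apply: (le_lt_trans (hC s 1%R s0 ltr01)).
  by apply: lte_mul_pinfty; rewrite ?lee_fin ?mulr_ge0 ?expR_ge0// ltW.
split; first by move=> s s0; rewrite fineK// Wfin.
split=> [s s0|e e0].
  rewrite -lte_fin fineK ?Wfin//.
  have [C C0 hC] := haar_norm_left_ge q w q0 hw.
  have w0 : 0 < (w (epoint (log_floor s)))%:E.
    by rewrite lte_fin; apply: (proj1 hw); exact: epoint_gt0.
  by have := lt_le_trans w0 (hC s s0); rewrite pmule_rgt0// lte_fin.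
have [C C0 hC] := haar_norm_left_growth q w e q0 hw e0; exists C => // s t s0 t0.
rewrite -lee_fin EFinM mul0r add0r !fineK ?Wfin//; exact: hC.
Qed.

End primitive.

(** ** Change of variables in discrete norms *)

Section coarse.
Context {R : realType}.
Local Open Scope ereal_scope.

Lemma doubling_iter (A : R) h n : (0 < A)%R -> doubling A h ->
  forall s t, (0 < s)%R -> (0 < t)%R -> (`|ln s - ln t| <= n%:R)%R ->
  h s <= (A ^+ n)%:E * h t.
Proof.
move=> A0 hh; elim: n => [|n IH] s t s0 t0 st.
  have /eqP : (ln s - ln t = 0)%R by apply/eqP; rewrite -normr_le0.
  by rewrite subr_eq0 => /eqP/ln_inj ->//; rewrite expr0 mul1e.
pose d := ((ln s - ln t) / n.+1%:R)%R; pose u := expR (ln s - d)%R.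
have hn : (n.+1%:R != 0 :> R)%R by rewrite pnatr_eq0.
have d1 : (`|d| <= 1)%R.
  by rewrite normrM normfV (ger0_norm (ler0n _ n.+1)) ler_pdivrMr ?ltr0n// mul1r.
have su : h s <= A%:E * h u.
  have [|_ //] := hh s u s0 (expR_gt0 _); rewrite expRK.
  by rewrite opprB addrCA subrr addr0.
have ut : h u <= (A ^+ n)%:E * h t.
  apply: IH => //; first exact: expR_gt0.
  have -> : (ln u - ln t = d * n%:R)%R.
    have : (ln s - ln t = d * n.+1%:R)%R by rewrite /d divfK.
    by rewrite expRK -natr1; lra.
  by rewrite normrM (ger0_norm (ler0n _ n)) ler_piMl.
by rewrite exprS; apply: le_mul_trans su ut; exact: ltW.
Qed.

(** A discrete intermediate value theorem: [ln (rho (e^j))] rises by at most [c + 2 * delta] per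
    step and is unbounded in both directions, so the last index before it first passes [m] is close
    enough. [tau] serves as an approximate inverse of [rho] on the logarithmic scale. *)
Lemma regvar_surj (delta : R) rho : (0 < delta)%R -> regvar delta rho ->
  exists B : R, exists tau : int -> int, forall m : int,
    (`|ln (rho (epoint (tau m))) - m%:~R| <= B)%R.
Proof.
move=> d0 hrho; pose L (j : int) := ln (rho (epoint j)).
have d2 : (0 < delta / 2)%R by rewrite divr_gt0.
have [c hc] := regvar_ln _ _ hrho _ d2.
have hL (j k : int) : (`|L j - L k - delta * (j - k)%:~R| <=
    c + delta / 2 * `|(j - k)%:~R|)%R.
  by have := hc _ _ (epoint_gt0 j) (epoint_gt0 k); rewrite !ln_epoint -rmorphN -intrD.
suff /boolp.choice[tau htau] : forall m, exists k,
    (`|ln (rho (epoint k)) - m%:~R| <= c + 2 * delta)%R.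
  by exists (c + 2 * delta)%R, tau.
move=> m.
have step (j : int) : (L (j + 1) <= L j + (c + 2 * delta))%R.
  have := hL (j + 1)%R j; rewrite (_ : j + 1 - j = 1)%R; last by ring.
  by rewrite normr1 ler_norml => /andP[_]; lra.
have large (n : nat) (j : int) : (L j + delta / 2 * n%:R - c <= L (j + n))%R.
  have := hL (j + n)%R j; rewrite (_ : j + n - j = n)%R; last by ring.
  by rewrite -pmulrn (ger0_norm (ler0n _ n)) ler_norml => /andP[]; lra.
have [n0 hn0] : exists n : nat, (L (- n%:Z) <= m%:~R)%R.
  exists (Num.bound `|(L 0 + c - m%:~R) / (delta / 2)|%R).
  set n := Num.bound _; have := large n (- n%:Z)%R; rewrite addNr.
  have : ((L 0 + c - m%:~R) / (delta / 2) <= n%:R)%R.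
    by apply: (le_trans (ler_norm _)); apply/ltW/archi_boundP.
  rewrite ler_pdivrMr//; lra.
have [n1 hn1] : exists n : nat, (m%:~R < L (- n0%:Z + n))%R.
  exists (Num.bound `|(m%:~R + c - L (- n0%:Z)) / (delta / 2)|%R).+1.
  set n := Num.bound _; have := large n.+1 (- n0%:Z)%R.
  have : ((m%:~R + c - L (- n0%:Z)) / (delta / 2) <= n%:R)%R.
    by apply: (le_trans (ler_norm _)); apply/ltW/archi_boundP.
  by rewrite ler_pdivrMr// -[n.+1%:R%R]natr1; lra.
pose Q n := (m%:~R < L (- n0%:Z + n%:Z))%R.
have exQ : exists n, Q n by exists n1.
case: (ex_minnP exQ) => -[|n] Qn Qmin; first by move: Qn; rewrite /Q addr0 ltNge hn0.
exists (- n0%:Z + n%:Z)%R.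
have nQ : (L (- n0%:Z + n%:Z) <= m%:~R)%R.
  by rewrite leNgt; apply/negP => /Qmin; rewrite ltnn.
have := step (- n0%:Z + n%:Z)%R; rewrite -addrA -PoszD addn1 => h.
rewrite ler0_norm ?subr_le0// opprB; move: Qn; rewrite /Q -/(L _); lra.
Qed.

(** [lam], the cell of [rho_k], and [tau] are inverse to each other up to bounded errors ([tri1],
    [tri2]). So both maps have bounded multiplicity, and composing a sequence with either of them
    costs a constant. *)
Lemma lq_regvar_reindex q (A delta : R) rho : 0 < q -> (0 < A)%R ->
  (0 < delta)%R -> regvar delta rho ->
  exists2 C : R, (0 < C)%R & forall h, doubling A h ->
  lq q (h \o epoint) <= C%:E * lq q (h \o rho \o epoint) /\
  lq q (h \o rho \o epoint) <= C%:E * lq q (h \o epoint).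
Proof.
move=> q0 A0 d0 hrho; have [B [tau htau]] := regvar_surj _ _ d0 hrho.
have rho0 k : (0 < rho (epoint k))%R by apply: (proj1 hrho); exact: epoint_gt0.
pose L (j : int) := ln (rho (epoint j)); pose lam (j : int) := Num.floor (L j).
have lamL j : (`|L j - (lam j)%:~R| <= 1)%R.
  rewrite ger0_norm ?subr_ge0 ?floor_le//.
  by have := floorD1_gt (L j); rewrite intrD -/(lam j) => /ltW; lra.
have d2 : (0 < delta / 2)%R by rewrite divr_gt0.
have [c hc] := regvar_ln _ _ hrho _ d2.
have hL (j k : int) : (`|L j - L k - delta * (j - k)%:~R| <=
    c + delta / 2 * `|(j - k)%:~R|)%R.
  by have := hc _ _ (epoint_gt0 j) (epoint_gt0 k); rewrite !ln_epoint -rmorphN -intrD.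
have tri1 m : (`|(m - lam (tau m))%:~R| <= B + 1 :> R)%R.
  rewrite intrD rmorphN; have := htau m; rewrite -/(L (tau m)); have := lamL (tau m).
  by rewrite !ler_norml => /andP[? ?] /andP[? ?]; apply/andP; split; lra.
(* With [x = k - tau (lam k)], tolerance [delta / 2] gives [delta |x| <= (B + 1) + c + (delta / 2)
   |x|]; half of the slope is left to solve for [|x|]. *)
have tri2 k : (`|(k - tau (lam k))%:~R| <= (B + 1 + c) / (delta / 2) :> R)%R.
  rewrite ler_pdivlMr//; have := hL k (tau (lam k)).
  have : (`|L k - L (tau (lam k))| <= B + 1)%R.
    have := htau (lam k); rewrite -/(L (tau (lam k))); have := lamL k.
    by rewrite !ler_norml => /andP[? ?] /andP[? ?]; apply/andP; split; lra.
  set x := _%:~R; set y := (L k - _)%R => hy.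
  have : (`|delta * x| <= `|y| + `|y - delta * x|)%R.
    by have := ler_normB y (y - delta * x)%R; rewrite subKr.
  by rewrite normrM (ger0_norm (ltW d0)); lra.
have [C C0 hC] := lq_schur q 1 q0 ltr01.
pose n := Num.bound `|B|%R.
have hn : (B <= n%:R)%R by apply: (le_trans (ler_norm _)); apply/ltW/archi_boundP.
pose K1 := (expR (B + 1) * A ^+ n)%R.
pose K2 := (expR ((B + 1 + c) / (delta / 2)) * A)%R.
have K10 : (0 < K1)%R by rewrite mulr_gt0 ?expR_gt0 ?exprn_gt0.
have K20 : (0 < K2)%R by rewrite mulr_gt0 ?expR_gt0.
exists (C * K1 + C * K2)%R; first by rewrite addr_gt0// mulr_gt0.
move=> h hh; have h0 u : (0 < u)%R -> 0 <= h u by exact: (doubling_ge0 _ _ _ hh).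
(* Bounded multiplicity through the Schur test: the kernel centred at [sig' j] is at least
   [expR (- M)] for [j = sig k], whence the factor [expR M]. *)
have main (x y : int -> \bar R) (sig sig' : int -> int) (D : R) (M K : R) :
    (forall k, 0 <= y k) -> (0 < D)%R -> K = (expR M * D)%R ->
    (forall k, x k <= D%:E * y (sig k)) ->
    (forall k, `|(k - sig' (sig k))%:~R| <= M :> R)%R ->
    lq q x <= (C * K)%:E * lq q y.
  move=> y0 D0 -> xy sM; rewrite EFinM -muleA.
  have K0 : (0 <= expR M * D)%R by rewrite mulr_ge0 ?expR_ge0 ?ltW.
  apply: (@le_trans _ _ (C%:E * lq q (fun j => (expR M * D)%:E * y j))); last first.
    by rewrite lee_wpmul2l ?lee_fin ?(ltW C0)//; apply: lq_scale.
  apply: (hC sig') => k; apply: le_trans (lq_point _ _ (sig k) q0).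
  apply: (le_trans (xy k)); rewrite muleA -EFinM lee_wpmul2r// lee_fin mulrA -expRD.
  apply: ler_peMl; first exact: ltW.
  by rewrite -[leLHS]expR0 ler_expR mul1r addrC subr_ge0.
have wide K' x y : 0 <= y -> (K' <= C * K1 + C * K2)%R -> x <= K'%:E * y ->
    x <= (C * K1 + C * K2)%:E * y.
  by move=> y0 KK xy; apply: (le_trans xy); rewrite lee_wpmul2r ?lee_fin.
split.
  apply: (wide (C * K1)%R).
  - exact: lq_ge0.
  - by rewrite lerDl mulr_ge0// ltW.
  apply: (main _ _ tau lam (A ^+ n)%R (B + 1)%R) => //.
  - by move=> k; apply: h0.
  - exact: exprn_gt0.
  - move=> k /=; apply: doubling_iter => //; first exact: epoint_gt0.
    by rewrite ln_epoint distrC (le_trans (htau k)).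
apply: (wide (C * K2)%R).
- exact: lq_ge0.
- by rewrite lerDr mulr_ge0// ltW.
apply: (main _ _ lam tau A ((B + 1 + c) / (delta / 2))%R) => //.
- by move=> k; apply: h0; exact: epoint_gt0.
- move=> k /=; have [|_ //] := hh (rho (epoint k)) (epoint (lam k)) (rho0 _) (epoint_gt0 _).
  by rewrite ln_epoint; exact: lamL.
Qed.

End coarse.

(** ** The K-functional *)

Section Kfun.
Context {R : realType} {E : lmodType R} {X0 X1 : qspace E}.
Local Open Scope ereal_scope.
Hypothesis X0_ge0 : forall x, carrier X0 x -> 0 <= qnorm X0 x.
Hypothesis X1_ge0 : forall x, carrier X1 x -> 0 <= qnorm X1 x.

Lemma Kfun_ge0 t f : (0 <= t)%R -> 0 <= Kfun X0 X1 t f.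
Proof.
move=> t0; apply: le_ereal_inf_tmp => _ [f0 [f1 [c0 c1 _ ->]]].
by rewrite adde_ge0 ?X0_ge0// mule_ge0 ?X1_ge0.
Qed.

Lemma Kfun_le t f0 f1 : carrier X0 f0 -> carrier X1 f1 ->
  Kfun X0 X1 t (f0 + f1)%R <= qnorm X0 f0 + t%:E * qnorm X1 f1.
Proof. by move=> c0 c1; apply: ereal_inf_lbound; exists f0, f1; split. Qed.

Lemma Kfun_mono s t f : (s <= t)%R -> Kfun X0 X1 s f <= Kfun X0 X1 t f.
Proof.
move=> st; apply: le_ereal_inf_tmp => _ [f0 [f1 [c0 c1 -> ->]]].
apply: (le_trans (Kfun_le s _ _ c0 c1)).
by rewrite leeD2l// lee_wpmul2r ?X1_ge0.
Qed.

Lemma Kfun_scale c t f : (1 <= c)%R -> (0 <= t)%R ->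
  Kfun X0 X1 (c * t)%R f <= c%:E * Kfun X0 X1 t f.
Proof.
move=> c1 t0; have c0 : (0 < c)%R by exact: lt_le_trans c1.
rewrite -lee_pdivrMl//; apply: le_ereal_inf_tmp => _ [f0 [f1 [cf0 cf1 -> ->]]].
rewrite lee_pdivrMl//; apply: (le_trans (Kfun_le _ _ _ cf0 cf1)).
rewrite ge0_muleDr ?X0_ge0 ?mule_ge0 ?X1_ge0// muleA -EFinM leeD2r//.
by rewrite -[leLHS]mul1e lee_wpmul2r ?X0_ge0.
Qed.

(** [K] is nondecreasing in [t] and [K(c t) <= c K(t)] for [c >= 1], so one logarithmic unit costs
    at most a factor [expR 1]. *)
Lemma Kfun_doubling f : doubling (expR 1) (fun u => Kfun X0 X1 u f).
Proof.
move=> s t s0 t0 st; split; first by rewrite Kfun_ge0// ltW.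
have [lest|/ltW lets] := leP s t.
  apply: (le_trans (Kfun_mono _ _ _ lest)); rewrite -[leLHS]mul1e.
  by rewrite lee_wpmul2r ?Kfun_ge0 ?(ltW t0)// lee_fin -[leLHS]expR0 ler_expR.
apply: (@le_trans _ _ (Kfun X0 X1 (expR 1 * t)%R f)).
  apply: Kfun_mono; rewrite -ler_ln ?posrE ?mulr_gt0 ?expR_gt0//.
  rewrite lnM ?posrE ?expR_gt0// expRK.
  by move: st; rewrite ler_norml => /andP[_]; lra.
by apply: Kfun_scale; rewrite ?(ltW t0)// -[leLHS]expR0 ler_expR.
Qed.

End Kfun.

(** * The K-functional of a quasi-Banach couple *)

Section Kfun_quasi_banach.
Context {R : realType} {E : lmodType R} {A0 A1 : qspace E}.
Local Open Scope ereal_scope.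
Hypothesis (qA0 : quasi_banach A0) (qA1 : quasi_banach A1).
Local Notation K := (Kfun A0 A1).

Lemma qnorm0 (X : qspace E) : quasi_banach X -> qnorm X 0%R = 0.
Proof.
move=> qX; have := qnormZ qX 0%R (carrier0 qX).
by rewrite scale0r normr0 mul0e.
Qed.

Lemma quasi_banachN (X : qspace E) x : quasi_banach X -> carrier X x ->
  carrier X (- x)%R /\ qnorm X (- x)%R = qnorm X x.
Proof.
move=> qX cx; rewrite -scaleN1r; split; first exact: carrierZ.
by rewrite qnormZ// normrN1 mul1e.
Qed.

Lemma sum_setl x : carrier A0 x -> sum_set A0 A1 x.
Proof.
by move=> cx; exists x, 0%R; split=> //; [exact: carrier0|rewrite addr0].
Qed.

Lemma sum_setr x : carrier A1 x -> sum_set A0 A1 x.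
Proof.
by move=> cx; exists 0%R, x; split=> //; [exact: carrier0|rewrite add0r].
Qed.

Lemma sum_setD x y : sum_set A0 A1 x -> sum_set A0 A1 y ->
  sum_set A0 A1 (x + y)%R.
Proof.
move=> [x0 [x1 [cx0 cx1 ->]]] [y0 [y1 [cy0 cy1 ->]]].
by exists (x0 + y0)%R, (x1 + y1)%R; split; [exact: carrierD|exact: carrierD|rewrite addrACA].
Qed.

Lemma Kfun_le0 t f : carrier A0 f -> K t f <= qnorm A0 f.
Proof.
move=> cf; have := Kfun_le t _ _ cf (carrier0 qA1).
by rewrite addr0 qnorm0// mule0 adde0.
Qed.

Lemma Kfun_le1 t f : carrier A1 f -> K t f <= t%:E * qnorm A1 f.
Proof.
move=> cf; have := Kfun_le t _ _ (carrier0 qA0) cf.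
by rewrite add0r qnorm0// add0e.
Qed.

Lemma Kfun_fin_num t f : (0 <= t)%R -> sum_set A0 A1 f -> K t f \is a fin_num.
Proof.
move=> t0 [f0 [f1 [c0 c1 ->]]]; rewrite ge0_fin_numE; last first.
  by apply: Kfun_ge0 => // x cx; exact: qnorm_ge0.
apply: (le_lt_trans (Kfun_le t _ _ c0 c1)).
by rewrite ltey_eq fin_numD fin_numM ?qnorm_fin.
Qed.

Lemma Kfun_add : exists2 C : R, (0 < C)%R & forall t f g, (0 <= t)%R ->
  K t (f + g)%R <= C%:E * (K t f + K t g).
Proof.
have [C0 hC0] := qnormD qA0; have [C1 hC1] := qnormD qA1.
(* The constants from [qnormD] come without a sign; the maximum with [1] makes [C] positive. *)
pose C := Num.max 1%R (Num.max C0 C1); have C1' : (1 <= C)%R by rewrite le_max lexx.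
have Cpos : (0 < C)%R by exact: lt_le_trans C1'.
exists C => // t f g t0.
have n0 x : carrier A0 x -> 0 <= qnorm A0 x by exact: qnorm_ge0.
have n1 x : carrier A1 x -> 0 <= qnorm A1 x by exact: qnorm_ge0.
have Kg0 h : 0 <= K t h by exact: Kfun_ge0.
have step f0 f1 g0 g1 : carrier A0 f0 -> carrier A1 f1 -> carrier A0 g0 ->
    carrier A1 g1 -> K t (f0 + f1 + (g0 + g1))%R <= C%:E *
      ((qnorm A0 f0 + t%:E * qnorm A1 f1) + (qnorm A0 g0 + t%:E * qnorm A1 g1)).
  move=> cf0 cf1 cg0 cg1; rewrite addrACA.
  apply: (le_trans (Kfun_le t _ _ (carrierD qA0 cf0 cg0) (carrierD qA1 cf1 cg1))).
  rewrite addeACA ge0_muleDr ?adde_ge0 ?n0 ?mule_ge0 ?n1//; apply: leeD.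
    apply: (le_trans (hC0 _ _ cf0 cg0)); rewrite lee_wpmul2r ?adde_ge0 ?n0//.
    by rewrite lee_fin !le_max lexx orbT.
  rewrite -ge0_muleDr ?n1// muleCA lee_wpmul2l//.
  apply: (le_trans (hC1 _ _ cf1 cg1)); rewrite lee_wpmul2r ?adde_ge0 ?n1//.
  by rewrite lee_fin !le_max lexx !orbT.
have [->|Kf] := eqVneq (K t f) +oo.
  by rewrite addye ?gt0_muley ?leey ?lte_fin// gt_eqF// (lt_le_trans _ (Kg0 g)).
have [->|Kg] := eqVneq (K t g) +oo.
  by rewrite addey ?gt0_muley ?leey ?lte_fin// gt_eqF// (lt_le_trans _ (Kg0 f)).
have Kf' : K t f \is a fin_num by rewrite ge0_fin_numE// ltey.
have Kg' : K t g \is a fin_num by rewrite ge0_fin_numE// ltey.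
apply/lee_addgt0Pr => e e0.
have d0 : (0 < e / (2 * C))%R by rewrite divr_gt0// mulr_gt0.
have [_ [f0 [f1 [cf0 cf1 fE ->]]] hf] := lb_ereal_inf_adherent d0 Kf'.
have [_ [g0 [g1 [cg0 cg1 gE ->]]] hg] := lb_ereal_inf_adherent d0 Kg'.
have st := step _ _ _ _ cf0 cf1 cg0 cg1; rewrite -fE -gE in st; apply: (le_trans st).
have -> : C%:E * (K t f + K t g) + e%:E =
    C%:E * ((K t f + (e / (2 * C))%:E) + (K t g + (e / (2 * C))%:E)).
  rewrite addeACA -EFinD [RHS]ge0_muleDr ?adde_ge0 ?lee_fin ?addr_ge0 ?(ltW d0)//.
  by rewrite -EFinM; congr (_ + _%:E); field; rewrite gt_eqF.
by rewrite lee_wpmul2l ?lee_fin ?(ltW Cpos)// leeD// ltW.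
Qed.

End Kfun_quasi_banach.

(** ** A Holmstedt-type formula *)

Section holmstedt.
Context {R : realType} {E : lmodType R} {A0 A1 X0 X1 : qspace E}.
Local Open Scope ereal_scope.
Hypothesis (qA0 : quasi_banach A0) (qA1 : quasi_banach A1).
Local Notation K := (Kfun A0 A1).
Context {theta0 theta1 : R} {r0 r1 q1 : \bar R} {beta0 beta1 w W : R -> R}.
Hypothesis (htheta0 : (0 < theta0)%R) (htheta01 : (theta0 < theta1)%R)
  (htheta1 : (theta1 < 1)%R).
Hypothesis (hr0 : 0 < r0) (hr1 : 0 < r1) (hq1 : 0 < q1).
Hypothesis (hbeta0 : regvar (- theta0)%R beta0)
  (hbeta1 : regvar (- theta1)%R beta1) (hw : regvar 0%R w) (hW : regvar 0%R W).
Hypothesis hWw : exists2 C : R, (0 < C)%R & forall k : int,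
  lq r1 (keep (fun i => (i <= k)%R) (EFin \o w \o epoint)) <= C%:E * (W (epoint k))%:E /\
  (W (epoint k))%:E <= C%:E * lq r1 (keep (fun i => (i <= k)%R) (EFin \o w \o epoint)).

Definition Kseq (beta : R -> R) (f : E) (j : int) : \bar R :=
  (beta (epoint j))%:E * K (epoint j) f.

Definition dnorm0 (f : E) : \bar R := lq r0 (Kseq beta0 f).

Definition dnorm1 (f : E) : \bar R :=
  lq r1 (fun i => (w (epoint i))%:E *
    lq q1 (keep (fun j => (i <= j)%R) (Kseq beta1 f))).

Definition equivalent_on_sum (X : qspace E) (N : E -> \bar R) : Prop :=
  [/\ forall f, carrier X f <-> sum_set A0 A1 f /\ qnorm X f < +oo,
      forall f, 0 <= qnorm X f &
      exists2 C : R, (0 < C)%R & forall f, sum_set A0 A1 f ->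
        qnorm X f <= C%:E * N f /\ N f <= C%:E * qnorm X f].

Hypothesis hX0 : equivalent_on_sum X0 dnorm0.
Hypothesis hX1 : equivalent_on_sum X1 dnorm1.

(** The quotient of the weights with which [K(t, f)] is controlled by the norms of [X0] and [X1]:
    [beta0 K] by the former and, by [Kfun_le_dnorm1], [beta1 W K] by the latter. *)
Let rho t := (beta0 t / (beta1 t * W t))%R.

Let beta0_gt0 k : (0 < beta0 (epoint k))%R.
Proof. by apply: (proj1 hbeta0); exact: epoint_gt0. Qed.
Let beta1_gt0 k : (0 < beta1 (epoint k))%R.
Proof. by apply: (proj1 hbeta1); exact: epoint_gt0. Qed.
Let w_gt0 k : (0 < w (epoint k))%R.
Proof. by apply: (proj1 hw); exact: epoint_gt0. Qed.
Let W_gt0 k : (0 < W (epoint k))%R.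
Proof. by apply: (proj1 hW); exact: epoint_gt0. Qed.
Let rho_gt0 k : (0 < rho (epoint k))%R.
Proof. by rewrite /rho divr_gt0// mulr_gt0. Qed.

Let n0 x : carrier A0 x -> 0 <= qnorm A0 x. Proof. exact: qnorm_ge0. Qed.
Let n1 x : carrier A1 x -> 0 <= qnorm A1 x. Proof. exact: qnorm_ge0. Qed.
Let K_ge0 k f : 0 <= K (epoint k) f.
Proof. by apply: Kfun_ge0 => //; rewrite ltW// epoint_gt0. Qed.
Let K_fin k f : sum_set A0 A1 f -> K (epoint k) f \is a fin_num.
Proof. by apply: Kfun_fin_num => //; rewrite ltW// epoint_gt0. Qed.

Lemma Kseq_ge0 beta f k : (0 < beta (epoint k))%R -> 0 <= Kseq beta f k.
Proof. by move=> b0; rewrite mule_ge0// lee_fin ltW. Qed.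

Lemma regvar_rho : regvar (theta1 - theta0)%R rho.
Proof.
apply: (eq_regvar _ _ _ _ _ _ (regvarM _ _ _ _ hbeta0
  (regvarV _ _ (regvarM _ _ _ _ hbeta1 hW)))) => //.
by ring.
Qed.

Let normr_intB_le (j k : int) : (j <= k)%R ->
  (`|(j - k)%:~R| = - (j - k)%:~R :> R)%R.
Proof. by move=> jk; rewrite ler0_norm// lerz0 subr_le0. Qed.

Let normr_intB_ge (j k : int) : (k <= j)%R ->
  (`|(j - k)%:~R| = (j - k)%:~R :> R)%R.
Proof. by move=> jk; rewrite ger0_norm// ler0z subr_ge0. Qed.

(* The only lower estimate on the norm of [X1] that is needed. *)
Lemma Kfun_le_dnorm1 : exists2 C : R, (0 < C)%R & forall f k, sum_set A0 A1 f ->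
  (beta1 (epoint k) * W (epoint k))%:E * K (epoint k) f <= C%:E * dnorm1 f.
Proof.
have [C C0 hC] := hWw; exists C => // f k sf.
have yfin : Kseq beta1 f k = (beta1 (epoint k) * fine (K (epoint k) f))%:E.
  by rewrite /Kseq EFinM fineK// K_fin.
set y := (beta1 (epoint k) * fine (K (epoint k) f))%R in yfin.
have y0 : (0 <= y)%R by rewrite mulr_ge0 ?fine_ge0// ltW.
have -> : (beta1 (epoint k) * W (epoint k))%:E * K (epoint k) f =
    y%:E * (W (epoint k))%:E.
  by rewrite -yfin /Kseq EFinM muleAC.
apply: (@le_trans _ _ (y%:E * (C%:E *
    lq r1 (keep (fun i => (i <= k)%R) (EFin \o w \o epoint))))).
  by rewrite lee_wpmul2l ?lee_fin//; have [_] := hC k.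
rewrite muleCA lee_wpmul2l ?lee_fin ?(ltW C0)//.
apply: (le_trans (lq_scale_ge _ _ _ hr1 y0)).
(* For each [i <= k] the inner norm over [j >= i] contains the term [j = k]; the norm of [w] over
   these [i] is comparable to [W]. *)
apply: lq_le => // i; rewrite /keep; case: ifPn => ik; last first.
  by rewrite mule0 mule_ge0 ?lq_ge0// lee_fin ltW.
rewrite muleC lee_wpmul2l ?lee_fin ?(ltW (w_gt0 _))// -yfin.
have := lq_point q1 (keep (fun j => (i <= j)%R) (Kseq beta1 f)) k hq1.
by rewrite {1}/keep ik.
Qed.

(** Take any splitting [f = f0 + f1]. The part of [f0] in [I_k] is at most its full norm. For [f1],
    [beta0 K = rho (beta1 W K)] is at most a multiple of [rho_j] times the norm of [f1]; as [rho_j]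
    decays geometrically when [j] decreases from [k], the sum is of the size of its term at [k]. *)
Lemma holmstedt_lower : exists2 C : R, (0 < C)%R & forall f k,
  lq r0 (keep (fun j => (j <= k)%R) (Kseq beta0 f)) <=
  C%:E * Kfun X0 X1 (rho (epoint k)) f.
Proof.
have [B B0 hB] := Kfun_add qA0 qA1.
have [L L0 hL] := Kfun_le_dnorm1.
have [c0 p0 [D0 D00 hD0]] := hX0; have [c1 p1 [D1 D10 hD1]] := hX1.
have d2 : (0 < (theta1 - theta0) / 2)%R by rewrite divr_gt0// subr_gt0.
have [P P0 hP] := regvar_epoint _ _ regvar_rho _ d2.
have [G G0 hG] := lq_geo r0 _ hr0 d2.
have [F F0 hF] := lq_add r0 hr0.
pose C := (B * (F * (D0 + G * (L * P) * D1)))%R.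
have C0 : (0 < C)%R by rewrite !mulr_gt0// addr_gt0// !mulr_gt0.
exists C => // f k; rewrite -lee_pdivrMl//.
apply: le_ereal_inf_tmp => _ [f0 [f1 [cf0 cf1 -> ->]]]; rewrite lee_pdivrMl//.
have [sf0 _] := (c0 f0).1 cf0; have [sf1 _] := (c1 f1).1 cf1.
have rk := rho_gt0 k.
have LPr : (0 < L * P * rho (epoint k))%R by apply: mulr_gt0 rk; exact: mulr_gt0.
apply: (@le_trans _ _ (B%:E * lq r0 (fun j =>
    keep (fun j => (j <= k)%R) (Kseq beta0 f0) j +
    keep (fun j => (j <= k)%R) (Kseq beta0 f1) j))).
  apply: le_trans (lq_scale _ _ _ hr0 (ltW B0)); apply: lq_le => // j.
  rewrite /keep; case: ifPn => _; last by rewrite adde0 mule0.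
  rewrite /Kseq -ge0_muleDr// muleCA lee_wpmul2l ?lee_fin ?(ltW (beta0_gt0 _))//.
  by apply: hB; rewrite ltW// epoint_gt0.
rewrite /C EFinM -muleA lee_wpmul2l ?lee_fin ?(ltW B0)//.
apply: (le_trans (hF _ _)).
rewrite EFinM -muleA lee_wpmul2l ?lee_fin ?(ltW F0)//.
rewrite ge0_muleDr ?p0 ?mule_ge0 ?lee_fin ?(ltW rk) ?p1//; apply: leeD.
  apply: (@le_trans _ _ (D0%:E * qnorm X0 f0)); last first.
    by rewrite lee_wpmul2r ?p0// lee_fin lerDl !mulr_ge0// ltW.
  apply: (le_trans _ (hD0 f0 sf0).2); apply: lq_le => // j.
  by rewrite /keep; case: ifPn => // _; exact: Kseq_ge0.
apply: (@le_trans _ _ ((G * (L * P) * D1)%:E *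
    ((rho (epoint k))%:E * qnorm X1 f1))); last first.
  rewrite lee_wpmul2r ?mule_ge0 ?p1// ?lee_fin ?(ltW rk)//.
  by rewrite lerDr ltW.
have dn0 : 0 <= dnorm1 f1 by exact: lq_ge0.
apply: (@le_trans _ _ (G%:E * ((L * P * rho (epoint k))%:E * dnorm1 f1))); last first.
  have -> : (G * (L * P) * D1)%:E * ((rho (epoint k))%:E * qnorm X1 f1) =
      G%:E * ((L * P * rho (epoint k))%:E * (D1%:E * qnorm X1 f1)).
    by rewrite !muleA -!EFinM; congr (_%:E * _); ring.
  apply: lee_wpmul2l; first by rewrite lee_fin ltW.
  apply: lee_wpmul2l; last exact: (hD1 f1 sf1).2.
  by rewrite lee_fin ltW.
apply: (hG _ k); first by rewrite mule_ge0// lee_fin ltW.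
move=> j; rewrite /keep; case: ifPn => jk; last first.
  by rewrite !mule_ge0// lee_fin ?expR_ge0// ltW.
have -> : Kseq beta0 f1 j = (rho (epoint j))%:E *
    ((beta1 (epoint j) * W (epoint j))%:E * K (epoint j) f1).
  rewrite /Kseq muleA -EFinM /rho divfK// gt_eqF// mulr_gt0//.
apply: (@le_trans _ _ ((rho (epoint j))%:E * (L%:E * dnorm1 f1))).
  by rewrite lee_wpmul2l ?lee_fin ?(ltW (rho_gt0 _))// hL.
rewrite !muleA -!EFinM lee_wpmul2r// lee_fin.
have := hP j k; rewrite normr_intB_le// => h.
rewrite mulrC; apply: (le_trans (ler_wpM2l (ltW L0) h)).
rewrite (_ : - ((theta1 - theta0) / 2 * - (j - k)%:~R) = (theta1 - theta0) * (j - k)%:~R +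
  (theta1 - theta0) / 2 * - (j - k)%:~R)%R; last by field.
by rewrite le_eqVlt; apply/orP; left; apply/eqP; ring.
Qed.

(** On one side of [k] each piece is estimated directly, by [K(t, f0) <= |f0|] or
    [K(t, f1) <= t |f1|]; on the other side it is [f] minus the other piece. [M] is any real above
    [K(e^k, f)], so that [K = 0] needs no separate case. *)
Lemma K_decomposition : exists2 B : R, (0 < B)%R & forall f k (M : R),
  K (epoint k) f < M%:E -> exists f0 f1,
  [/\ carrier A0 f0, carrier A1 f1, f = (f0 + f1)%R,
    forall j, K (epoint j) f0 <= B%:E *
      (if (j <= k)%R then K (epoint j) f + (expR (j - k)%:~R * M)%:E else M%:E) &
    forall j, K (epoint j) f1 <= B%:E *
      (if (j <= k)%R then (expR (j - k)%:~R * M)%:E else K (epoint j) f + M%:E)].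
Proof.
have [B0 B00 hB] := Kfun_add qA0 qA1.
exists (B0 + 1)%R; first by rewrite addr_gt0.
move=> f k M /ereal_inf_lt[_ [f0 [f1 [cf0 cf1 fE ->]]] /ltW hM].
have ek : (0 <= epoint k :> R)%R by rewrite ltW// epoint_gt0.
have M0 : (0 <= M)%R by rewrite -lee_fin (le_trans _ hM)// adde_ge0 ?n0 ?mule_ge0 ?n1.
have a0 : qnorm A0 f0 <= M%:E by apply: le_trans hM; rewrite leeDl// mule_ge0 ?n1.
have a1 : qnorm A1 f1 <= ((epoint k)^-1 * M)%:E.
  rewrite EFinM lee_pdivlMl ?epoint_gt0//; apply: le_trans hM.
  by rewrite leeDr// n0.
have a1j j : (epoint j)%:E * qnorm A1 f1 <= (expR (j - k)%:~R * M)%:E.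
  have -> : (expR (j - k)%:~R * M)%:E = (epoint j)%:E * ((epoint k)^-1 * M)%:E :> \bar R.
    by rewrite -EFinM mulrA intrD rmorphN expRD expRN.
  by rewrite lee_wpmul2l// lee_fin ltW// epoint_gt0.
have wide (x y : \bar R) : 0 <= y -> x <= y -> x <= (B0 + 1)%:E * y.
  move=> y0 xy; apply: (le_trans xy); rewrite -[leLHS]mul1e lee_wpmul2r// lee_fin.
  by rewrite lerDr ltW.
have wideB (x y : \bar R) : 0 <= y -> x <= B0%:E * y -> x <= (B0 + 1)%:E * y.
  move=> y0 xy; apply: (le_trans xy); rewrite lee_wpmul2r// lee_fin.
  by rewrite lerDl.
have eM0 j : 0 <= (expR (j - k)%:~R * M)%:E :> \bar R by rewrite lee_fin mulr_ge0 ?expR_ge0.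
have ej j : (0 <= epoint j :> R)%R by rewrite ltW// epoint_gt0.
have [nf0 nf0E] := quasi_banachN _ _ qA0 cf0.
have [nf1 nf1E] := quasi_banachN _ _ qA1 cf1.
exists f0, f1; split=> // j; case: ifPn => jk.
- apply: wideB; first exact: adde_ge0.
  rewrite (_ : f0 = f + - f1)%R; last by rewrite fE addrK.
  apply: (le_trans (hB _ _ _ (ej j))); rewrite lee_wpmul2l ?lee_fin ?(ltW B00)// leeD2l//.
  by apply: (le_trans (Kfun_le1 qA0 _ _ nf1)); rewrite nf1E.
- by apply: wide => //; apply: le_trans (Kfun_le0 qA1 _ _ cf0) _.
- by apply: wide => //; apply: (le_trans (Kfun_le1 qA0 _ _ cf1)).
- apply: wideB; first by rewrite adde_ge0.
  rewrite (_ : f1 = f + - f0)%R; last by rewrite fE addrAC subrr add0r.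
  apply: (le_trans (hB _ _ _ (ej j))); rewrite lee_wpmul2l ?lee_fin ?(ltW B00)// leeD2l//.
  by apply: (le_trans (Kfun_le0 qA1 _ _ nf0)); rewrite nf0E.
Qed.

Lemma dnorm0_le (B : R) : (0 < B)%R -> exists2 C : R, (0 < C)%R &
  forall f f0 k (M : R), (0 <= M)%R ->
  (forall j, K (epoint j) f0 <= B%:E *
    (if (j <= k)%R then K (epoint j) f + (expR (j - k)%:~R * M)%:E else M%:E)) ->
  dnorm0 f0 <= C%:E * (lq r0 (keep (fun j => (j <= k)%R) (Kseq beta0 f)) +
                      (beta0 (epoint k) * M)%:E).
Proof.
(* [beta0] has index [- theta0], so the error terms decay with exponent [theta0] above [k] and
   [1 - theta0] below it. One [e] goes to the Potter error, and at least one [e] remains as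
   decay. *)
move=> B0; pose e := (Num.min theta0 (1 - theta0) / 2)%R.
have e1 : (e * 2 <= theta0)%R by rewrite divfK// ge_min lexx.
have e2 : (e * 2 <= 1 - theta0)%R by rewrite divfK// ge_min lexx orbT.
have e0 : (0 < e)%R.
  by rewrite divr_gt0// lt_min htheta0 subr_gt0; exact: lt_trans htheta01 htheta1.
have [P P0 hP] := regvar_epoint _ _ hbeta0 _ e0.
have [G G0 hG] := lq_geo r0 _ hr0 e0.
have [F F0 hF] := lq_add r0 hr0.
exists (B * (F * (1 + G * P)))%R.
  by rewrite !mulr_gt0// addr_gt0// mulr_gt0.
move=> f f0 k M M0 h; set I := lq r0 (keep _ _).
have bM0 : (0 <= beta0 (epoint k) * M)%R by rewrite mulr_ge0// ltW.
pose z j := (expR (- (e * `|(j - k)%:~R|)))%:E * (P * (beta0 (epoint k) * M))%:E : \bar R.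
have z0 j : 0 <= z j by rewrite mule_ge0 ?lee_fin ?expR_ge0// mulr_ge0// ltW.
have zE j : (expR (Num.min 0 (j - k)%:~R) * M * beta0 (epoint j))%:E <= z j.
  rewrite /z -EFinM lee_fin.
  apply: (@le_trans _ _ (expR (Num.min 0 (j - k)%:~R) * M * (P *
      expR (- theta0 * (j - k)%:~R + e * `|(j - k)%:~R|) * beta0 (epoint k)))%R).
    by rewrite ler_wpM2l ?hP// mulr_ge0 ?expR_ge0.
  rewrite (_ : expR (Num.min 0 (j - k)%:~R) * M * (P *
      expR (- theta0 * (j - k)%:~R + e * `|(j - k)%:~R|) * beta0 (epoint k)) =
    expR (Num.min 0 (j - k)%:~R + (- theta0 * (j - k)%:~R + e * `|(j - k)%:~R|)) *
    (P * (beta0 (epoint k) * M)))%R; last by rewrite [in RHS]expRD; ring.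
  rewrite ler_wpM2r ?mulr_ge0 ?(ltW P0) ?(ltW (beta0_gt0 _))// ler_expR.
  have [jk|jk] := leP j k.
    have d : ((j - k)%:~R <= 0 :> R)%R by rewrite lerz0 subr_le0.
    by rewrite normr_intB_le// (min_idPr d); nra.
  have d : (0 <= (j - k)%:~R :> R)%R by rewrite ler0z subr_ge0 ltW.
  by rewrite normr_intB_ge ?(ltW jk)// (min_idPl d); nra.
apply: (@le_trans _ _ (B%:E * lq r0 (fun j =>
    keep (fun j => (j <= k)%R) (Kseq beta0 f) j + z j))).
  apply: le_trans (lq_scale _ _ _ hr0 (ltW B0)); apply: lq_le => // j.
  apply: (@le_trans _ _ (B%:E * ((beta0 (epoint j))%:E * (if (j <= k)%R then
      K (epoint j) f + (expR (j - k)%:~R * M)%:E else M%:E)))).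
    by rewrite muleCA /Kseq lee_wpmul2l ?lee_fin ?(ltW (beta0_gt0 _)).
  apply: lee_wpmul2l; first by rewrite lee_fin ltW.
  have := zE j; rewrite /keep; case: ifPn => jk.
    have d : ((j - k)%:~R <= 0 :> R)%R by rewrite lerz0 subr_le0.
    rewrite (min_idPr d) => hz.
    rewrite ge0_muleDr ?lee_fin ?mulr_ge0 ?expR_ge0//; apply: leeD => //.
    by rewrite -EFinM mulrC.
  have d : (0 <= (j - k)%:~R :> R)%R by rewrite ler0z subr_ge0 ltW// ltNge.
  by rewrite (min_idPl d) expR0 mul1r add0e -EFinM mulrC.
rewrite EFinM -muleA lee_wpmul2l ?lee_fin ?(ltW B0)//.
apply: (le_trans (hF _ _)); rewrite EFinM -muleA lee_wpmul2l ?lee_fin ?(ltW F0)//.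
have I0 : 0 <= I by exact: lq_ge0.
have GP0 : (0 <= G * P)%R by rewrite mulr_ge0// ltW.
rewrite ge0_muleDr ?lee_fin//; apply: leeD.
  by rewrite -[leLHS]mul1e lee_wpmul2r// lee_fin lerDl.
apply: (@le_trans _ _ (G%:E * (P * (beta0 (epoint k) * M))%:E)).
  by apply: (hG _ k) => //; rewrite lee_fin mulr_ge0// ltW.
by rewrite -!EFinM lee_fin mulrA ler_wpM2r// lerDr.
Qed.

(** The inner norm over [j >= i] is of order [Q / W_k] for [i <= k] and has an extra factor
    [e^(- e (i - k))] for [i > k]. The outer norm over [i <= k] then restores [W_k]; for [i > k] the
    weight [w] grows by at most half of that exponent, starting from [w_k <~ W_k]. *)
Lemma dnorm1_le (e : R) : (0 < e)%R -> exists2 C : R, (0 < C)%R &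
  forall f k (Q : R), (0 <= Q)%R ->
  (forall j, Kseq beta1 f j <=
    (expR (- (e * `|(j - k)%:~R|)) * (Q / W (epoint k)))%:E) ->
  dnorm1 f <= C%:E * Q%:E.
Proof.
move=> e0; have e2 : (0 < e / 2)%R by rewrite divr_gt0.
have [G G0 hG] := lq_geo q1 _ hq1 e0.
have [G' G'0 hG'] := lq_geo r1 _ hr1 e2.
have [P P0 hP] := regvar_epoint _ _ hw _ e2.
have [F F0 hF] := lq_add r1 hr1.
have [V V0 hV] := hWw.
exists (G * (F * (V + G' * (P * V))))%R.
  by rewrite !mulr_gt0// addr_gt0// !mulr_gt0.
move=> f k Q Q0 h; set D := (Q / W (epoint k))%R.
rewrite -/D in h.
have Wk := W_gt0 k; have D0 : (0 <= D)%R by rewrite divr_ge0// ltW.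
have inner i : lq q1 (keep (fun j => (i <= j)%R) (Kseq beta1 f)) <=
    G%:E * (expR (- (e * Num.max 0 (i - k)%:~R)) * D)%:E.
  have [ik|ik] := leP i k.
    have d : ((i - k)%:~R <= 0 :> R)%R by rewrite lerz0 subr_le0.
    rewrite (max_idPl d) mulr0 oppr0 expR0 mul1r; apply: (hG _ k) => // j.
    rewrite /keep; case: ifPn => ij; first by rewrite -EFinM.
    by rewrite -EFinM lee_fin mulr_ge0 ?expR_ge0.
  have d : (0 <= (i - k)%:~R :> R)%R by rewrite ler0z subr_ge0 ltW.
  rewrite (max_idPr d); apply: (hG _ i); first by rewrite lee_fin mulr_ge0 ?expR_ge0.
  move=> j; rewrite /keep -EFinM; case: ifPn => ij; last first.
    by rewrite lee_fin mulr_ge0 ?expR_ge0// mulr_ge0 ?expR_ge0.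
  apply: (le_trans (h j)); rewrite lee_fin [leRHS]mulrA -expRD ler_wpM2r// ler_expR.
  rewrite !normr_intB_ge//; last exact: le_trans (ltW ik) ij.
  by rewrite !intrD !rmorphN /=; lra.
pose z i := if (k < i)%R then (w (epoint i) * expR (- (e * (i - k)%:~R)))%:E else 0 : \bar R.
pose u := keep (fun i => (i <= k)%R) (EFin \o w \o epoint).
apply: (@le_trans _ _ ((G * D)%:E * lq r1 (fun i => u i + z i))).
  have GD0 : (0 <= G * D)%R by rewrite mulr_ge0// ltW.
  apply: le_trans (lq_scale _ _ _ hr1 GD0); apply: lq_le => // i.
  apply: (@le_trans _ _ ((w (epoint i))%:E *
      (G%:E * (expR (- (e * Num.max 0 (i - k)%:~R)) * D)%:E))).
    by apply: lee_wpmul2l => //; rewrite lee_fin ltW.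
  rewrite /u /keep /z; case: leP => ik.
    have d : ((i - k)%:~R <= 0 :> R)%R by rewrite lerz0 subr_le0.
    rewrite (max_idPl d) mulr0 oppr0 expR0 mul1r adde0 -!EFinM lee_fin.
    by rewrite le_eqVlt; apply/orP; left; apply/eqP; rewrite mulrC.
  have d : (0 <= (i - k)%:~R :> R)%R by rewrite ler0z subr_ge0 ltW.
  rewrite (max_idPr d) add0e -!EFinM lee_fin.
  by rewrite le_eqVlt; apply/orP; left; apply/eqP; ring.
have hu : lq r1 u <= V%:E * (W (epoint k))%:E by have [] := hV k.
have hz : lq r1 z <= G'%:E * (P * (V * W (epoint k)))%:E.
  apply: (hG' _ k); first by rewrite lee_fin !mulr_ge0// ltW.
  have wk : (w (epoint k) <= V * W (epoint k))%R.
    rewrite -lee_fin EFinM; apply: le_trans hu.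
    by have := lq_point r1 u k hr1; rewrite {1}/u /keep lexx.
  move=> i; rewrite /z -EFinM; case: ifPn => ik; last first.
    by rewrite lee_fin !mulr_ge0 ?expR_ge0// ltW.
  rewrite lee_fin; apply: (@le_trans _ _ (P * expR (0 * (i - k)%:~R +
      e / 2 * `|(i - k)%:~R|) * w (epoint k) * expR (- (e * (i - k)%:~R)))%R).
    by rewrite ler_wpM2r ?expR_ge0.
  rewrite normr_intB_ge ?(ltW ik)//.
  rewrite (_ : P * expR (0 * (i - k)%:~R + e / 2 * (i - k)%:~R) * w (epoint k) *
     expR (- (e * (i - k)%:~R)) = expR ((0 * (i - k)%:~R + e / 2 * (i - k)%:~R) +
     - (e * (i - k)%:~R)) * (P * w (epoint k)))%R; last by rewrite [in RHS]expRD; ring.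
  rewrite (_ : 0 * (i - k)%:~R + e / 2 * (i - k)%:~R + - (e * (i - k)%:~R) =
    - (e / 2 * (i - k)%:~R))%R; last by field.
  by rewrite ler_wpM2l ?expR_ge0// ler_wpM2l// ltW.
apply: (@le_trans _ _ ((G * D)%:E * (F%:E *
    (V%:E * (W (epoint k))%:E + G'%:E * (P * (V * W (epoint k)))%:E)))).
  apply: lee_wpmul2l; first by rewrite lee_fin mulr_ge0// ltW.
  apply: (le_trans (hF _ _)); apply: lee_wpmul2l; first by rewrite lee_fin ltW.
  exact: leeD.
rewrite -!EFinM lee_fin le_eqVlt; apply/orP; left; apply/eqP.
by rewrite /D; field; rewrite gt_eqF.
Qed.

(** Split [f] at level [k]. The piece [f0] costs [I_k] and one term at [k]. For [f1], the identity
    [beta0 = rho beta1 W] turns the hypothesis into [beta1_j W_j K_j <= e^(- e (j - k)) S / rho_k]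
    for [j >= k], and this decay is what [dnorm1_le] requires. [S] is any real bound for the
    weighted supremum. *)
Lemma holmstedt_upper (e : R) : (0 < e)%R -> exists2 C : R, (0 < C)%R &
  forall f k (S : R), sum_set A0 A1 f -> (0 <= S)%R ->
  lq r0 (keep (fun j => (j <= k)%R) (Kseq beta0 f)) < +oo ->
  (forall j, (k <= j)%R ->
    (rho (epoint k) / rho (epoint j) * expR (e * (j - k)%:~R))%:E *
      Kseq beta0 f j <= S%:E) ->
  sum_set X0 X1 f /\ Kfun X0 X1 (rho (epoint k)) f <=
    C%:E * (lq r0 (keep (fun j => (j <= k)%R) (Kseq beta0 f)) + S%:E).
Proof.
move=> e_gt0.
(* [e1] is the Potter error of [beta1], and [e'], at most [e], the decay kept afterwards. [dec0] and
   [dec1] say that both fit into the margins [1 - theta1] below [k] and [theta1] above it. *)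
have [e1 [e11 e12 e10]] : exists e1 : R,
    [/\ (e1 * 2 <= theta0)%R, (e1 * 2 <= 1 - theta1)%R & (0 < e1)%R].
  exists (Num.min theta0 (1 - theta1) / 2)%R.
  by rewrite divfK// !ge_min !lexx orbT divr_gt0// lt_min htheta0 subr_gt0.
have [e' [e'e e'e1 e'0]] : exists e', [/\ (e' <= e)%R, (e' <= e1)%R & (0 < e')%R].
  by exists (Num.min e e1); rewrite !ge_min !lexx orbT lt_min e_gt0.
have dec0 : (0 <= 1 - theta1 - e1 - e')%R by lra.
have dec1 : (0 <= theta1 - e1 - e')%R by move: htheta01; lra.
have [B B0 hB] := K_decomposition.
have [C0 C00 hC0] := dnorm0_le B B0.
have [C1 C10 hC1] := dnorm1_le e' e'0.
have [P P0 hP] := regvar_epoint _ _ hbeta1 _ e10.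
(* [W] is comparable to a primitive, hence nondecreasing up to a constant. *)
have [U U0 hU] : exists2 U : R, (0 < U)%R & forall j k : int, (k <= j)%R ->
    (W (epoint k) <= U * W (epoint j))%R.
  have [V V0 hV] := hWw; exists (V * V)%R; first exact: mulr_gt0.
  move=> j k kj; rewrite -lee_fin EFinM.
  apply: le_mul_trans (proj2 (hV k)) _; first exact: ltW.
  apply: le_trans (proj1 (hV j)); apply: lq_le => // i; rewrite /keep.
  by case: ifPn => ik; case: ifPn => ij //=; [rewrite (le_trans ik kj) in ij|rewrite lee_fin ltW].
have [c0 p0 [D0 D00 hD0]] := hX0; have [c1 p1 [D1 D10 hD1]] := hX1.
pose H := (B * (U + P))%R.
have H0 : (0 < H)%R by rewrite mulr_gt0// addr_gt0.
pose C := (2 * (D0 * C0) + D1 * C1 * H)%R.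
have Cp : (0 < C)%R.
  by apply: addr_gt0; apply: mulr_gt0 => //; exact: mulr_gt0.
exists C => // f k S sf S0; set I := lq r0 (keep _ _) => Ifin hS.
have I0 : 0 <= I by exact: lq_ge0.
have xk : Kseq beta0 f k <= I.
  by have := lq_point r0 (keep (fun j => (j <= k)%R) (Kseq beta0 f)) k hr0; rewrite {1}/keep lexx.
have bk := beta0_gt0 k; have b1k := beta1_gt0 k; have Wk := W_gt0 k; have rk := rho_gt0 k.
have [Ki KiE Ki0] : exists2 Ki : R, K (epoint k) f = Ki%:E & (0 <= Ki)%R.
  by exists (fine (K (epoint k) f)); [rewrite fineK// K_fin|rewrite fine_ge0].
have bKi : (beta0 (epoint k) * Ki)%:E <= I by rewrite EFinM -KiE.
(* Here [M] is only known to exceed [K(e^k, f)]. When it decreases to that value at the end,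
   [beta0 M] tends to a term bounded by [I], hence the factor [2] in [C]. *)
have main (M : R) : (Ki < M)%R -> sum_set X0 X1 f /\
    Kfun X0 X1 (rho (epoint k)) f <=
      (D0 * C0)%:E * (I + (beta0 (epoint k) * M)%:E) +
      (D1 * C1 * H)%:E * (S + beta0 (epoint k) * M)%:E.
  move=> KM; have M0 : (0 <= M)%R by exact: le_trans (ltW KM).
  have [|f0 [f1 [cf0 cf1 fE hf0 hf1]]] := hB f k M; first by rewrite KiE lte_fin.
  have sf0 := sum_setl qA1 _ cf0; have sf1 := sum_setr qA0 _ cf1.
  have N0 := hC0 f f0 k M M0 hf0.
  (* Chosen so that [rho_k Q = S + beta0_k M]. *)
  pose Q := (S / rho (epoint k) + beta1 (epoint k) * W (epoint k) * M)%R.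
  have Q0 : (0 <= Q)%R.
    by apply: addr_ge0; [apply: divr_ge0 => //; exact: ltW|rewrite !mulr_ge0// ltW].
  have bM j : (beta1 (epoint j) * (expR (Num.min 0 (j - k)%:~R) * M) <=
      expR (- (e' * `|(j - k)%:~R|)) * (P * (Q / W (epoint k))))%R.
    apply: (@le_trans _ _ (P * expR (- theta1 * (j - k)%:~R + e1 * `|(j - k)%:~R|) *
        beta1 (epoint k) * (expR (Num.min 0 (j - k)%:~R) * M))%R).
      by rewrite ler_wpM2r ?hP// mulr_ge0 ?expR_ge0.
    rewrite (_ : P * expR (- theta1 * (j - k)%:~R + e1 * `|(j - k)%:~R|) *
        beta1 (epoint k) * (expR (Num.min 0 (j - k)%:~R) * M) =
      expR ((- theta1 * (j - k)%:~R + e1 * `|(j - k)%:~R|) + Num.min 0 (j - k)%:~R) *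
      (P * (beta1 (epoint k) * M)))%R; last by rewrite [in RHS]expRD; ring.
    apply: ler_pM; rewrite ?expR_ge0 ?mulr_ge0 ?(ltW P0) ?(ltW b1k)//.
      rewrite ler_expR; have [jk|jk] := leP j k.
        have d : ((j - k)%:~R <= 0 :> R)%R by rewrite lerz0 subr_le0.
        have : ((1 - theta1 - e1 - e') * (j - k)%:~R <= 0)%R.
          exact: mulr_ge0_le0.
        by rewrite normr_intB_le// (min_idPr d); lra.
      have d : (0 <= (j - k)%:~R :> R)%R by rewrite ler0z subr_ge0 ltW.
      have : (0 <= (theta1 - e1 - e') * (j - k)%:~R)%R by exact: mulr_ge0.
      by rewrite normr_intB_ge ?(ltW jk)// (min_idPl d); lra.
    rewrite ler_wpM2l ?(ltW P0)// ler_pdivlMr// /Q mulrAC lerDr.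
    by apply: divr_ge0 => //; exact: ltW.
  have N1 : dnorm1 f1 <= C1%:E * (H * Q)%:E.
    apply: (hC1 _ k); first by rewrite mulr_ge0// ltW.
    move=> j; apply: (@le_trans _ _ (B%:E * ((expR (- (e' * `|(j - k)%:~R|)) *
        ((U + P) * (Q / W (epoint k))))%:E))); last first.
      by rewrite -EFinM lee_fin le_eqVlt; apply/orP; left; apply/eqP; rewrite /H; ring.
    apply: (@le_trans _ _ (B%:E * ((beta1 (epoint j))%:E * (if (j <= k)%R then
        (expR (j - k)%:~R * M)%:E else K (epoint j) f + M%:E)))).
      by rewrite muleCA lee_wpmul2l// lee_fin ltW.
    apply: lee_wpmul2l; first by rewrite lee_fin ltW.
    have QW0 : (0 <= Q / W (epoint k))%R by rewrite divr_ge0// ltW.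
    have := bM j; case: ifPn => jk.
      have d : ((j - k)%:~R <= 0 :> R)%R by rewrite lerz0 subr_le0.
      rewrite (min_idPr d) -EFinM lee_fin => /le_trans; apply.
      by rewrite ler_wpM2l ?expR_ge0// ler_wpM2r// lerDr ltW.
    have kj : (k <= j)%R by rewrite ltW// ltNge.
    have d : (0 <= (j - k)%:~R :> R)%R by rewrite ler0z subr_ge0.
    rewrite (min_idPl d) expR0 mul1r => hM.
    rewrite ge0_muleDr ?lee_fin// [((U + P) * _)%R]mulrDl mulrDr EFinD; apply: leeD; last first.
      by rewrite -EFinM lee_fin.
    have /(congr1 fine) KjE := erefl (K (epoint j) f).
    have Kj0 : (0 <= fine (K (epoint j) f))%R by rewrite fine_ge0.
    have := hS j kj; rewrite /Kseq -(fineK (K_fin j f sf)) -!EFinM !lee_fin.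
    move: (fine _) Kj0 => {KjE} x x0 hx.
    have rj := rho_gt0 j; have Wj := W_gt0 j; have b1j := beta1_gt0 j.
    have : (beta1 (epoint j) * W (epoint j) * x <=
        expR (- (e * (j - k)%:~R)) * (S / rho (epoint k)))%R.
      rewrite expRN [leRHS]mulrC ler_pdivlMr ?expR_gt0// ler_pdivlMr//.
      apply: le_trans hx; rewrite le_eqVlt; apply/orP; left; apply/eqP.
      have -> : (beta0 (epoint j) = rho (epoint j) * (beta1 (epoint j) * W (epoint j)))%R.
        by rewrite /rho divfK// gt_eqF// mulr_gt0.
      by field; rewrite gt_eqF.
    move=> hx'.
    have hx2 : (beta1 (epoint j) * W (epoint j) * x <= expR (- (e' * (j - k)%:~R)) * Q)%R.
      apply: (le_trans hx'); apply: ler_pM; rewrite ?expR_ge0//.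
      - by apply: divr_ge0 => //; exact: ltW.
      - by rewrite ler_expR lerN2 ler_wpM2r.
      - by rewrite /Q lerDl !mulr_ge0// ltW.
    rewrite normr_intB_ge//.
    have hUj := hU j k kj.
    rewrite mulrA mulrA ler_pdivlMr//.
    apply: (@le_trans _ _ (U * (beta1 (epoint j) * W (epoint j) * x))%R).
      rewrite (_ : U * (beta1 (epoint j) * W (epoint j) * x) =
        beta1 (epoint j) * x * (U * W (epoint j)))%R; last by ring.
      by rewrite ler_wpM2l// mulr_ge0// ltW.
    rewrite (_ : expR (- (e' * (j - k)%:~R)) * U * Q =
      U * (expR (- (e' * (j - k)%:~R)) * Q))%R; last by ring.
    by rewrite ler_wpM2l// ltW.
  have qX0 : qnorm X0 f0 <= (D0 * C0)%:E * (I + (beta0 (epoint k) * M)%:E).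
    by apply: le_mul_trans (proj1 (hD0 _ sf0)) N0; exact: ltW.
  have qX1 : qnorm X1 f1 <= (D1 * C1)%:E * (H * Q)%:E.
    by apply: le_mul_trans (proj1 (hD1 _ sf1)) N1; exact: ltW.
  have cX0 : carrier X0 f0.
    apply/c0; split=> //; apply: (le_lt_trans qX0).
    apply: lte_mul_pinfty; rewrite ?lee_fin ?mulr_ge0 ?(ltW D00) ?(ltW C00)//.
    by rewrite lte_add_pinfty// ltry.
  have cX1 : carrier X1 f1.
    by apply/c1; split=> //; apply: (le_lt_trans qX1); rewrite -EFinM ltry.
  split; first by exists f0, f1.
  rewrite {1}fE; apply: (le_trans (Kfun_le _ _ _ cX0 cX1)); apply: leeD => //.
  apply: (@le_trans _ _ ((rho (epoint k))%:E * ((D1 * C1)%:E * (H * Q)%:E))).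
    by rewrite lee_wpmul2l// lee_fin ltW.
  rewrite -!EFinM lee_fin le_eqVlt; apply/orP; left; apply/eqP.
  have -> : (beta0 (epoint k) = rho (epoint k) * (beta1 (epoint k) * W (epoint k)))%R.
    by rewrite /rho divfK// gt_eqF// mulr_gt0.
  by rewrite /Q; field; rewrite gt_eqF.
split; first by have [|] := main (Ki + 1)%R; rewrite ?ltrDl.
apply/lee_addgt0Pr => d d0.
(* Makes [beta0_k eta = d / C], so that the total excess stays below [d]. *)
pose eta := (d / (C * beta0 (epoint k)))%R.
have eta0 : (0 < eta)%R by rewrite divr_gt0// mulr_gt0.
have [|_ h] := main (Ki + eta)%R; first by rewrite ltrDl.
apply: (le_trans h).
have ->: I = (fine I)%:E by rewrite fineK// ge0_fin_numE.
have : (beta0 (epoint k) * Ki <= fine I)%R by rewrite -lee_fin fineK// ge0_fin_numE.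
move: (fine I) => i hi; rewrite -!(EFinD, EFinM) lee_fin.
have etaE : (beta0 (epoint k) * eta = d / C)%R by rewrite /eta; field; rewrite !gt_eqF.
have DC : (0 <= D0 * C0)%R by rewrite mulr_ge0// ltW.
have DH : (0 <= D1 * C1 * H)%R := mulr_ge0 (mulr_ge0 (ltW D10) (ltW C10)) (ltW H0).
have dC : (0 <= d / C)%R by rewrite divr_ge0// ltW.
rewrite [(beta0 _ * (Ki + eta))%R]mulrDr etaE [X in (_ <= _ + X)%R](_ : d = C * (d / C))%R; last first.
  by rewrite mulrC divfK// gt_eqF.
move: (d / C)%R dC => dd dC.
have h1 := ler_wpM2l DC hi; have h2 := ler_wpM2l DH hi.
have h3 := mulr_ge0 DC S0; have h4 := mulr_ge0 DC dC.
rewrite /C; lra.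
Qed.

(** * Summation of the Holmstedt estimates over all levels *)

Let I f k := lq r0 (keep (fun j => (j <= k)%R) (Kseq beta0 f)).
(** The sequence [v z] smoothed by the kernel of [lq_schur]: [M_k] dominates every [v_j z_j] up to a
    factor [e^(e |k - j|)], yet its [l^r] norm is at most a multiple of that of [v z]. *)
Let M (r : \bar R) (e : R) (v : R -> R) (z : int -> \bar R) (k : int) :=
  lq r (fun j => (expR (- (e * `|(k - j)%:~R|)))%:E * ((v (epoint j))%:E * z j)).

(** With [x = Kseq beta0 f] one has [x_j <= e^(e |k - j|) M_k / v_j], and [1 / v_j] falls off with
    exponent [theta (theta1 - theta0)] below [k]. Of the three [e], one pays for the kernel, one for
    the Potter error, and one is left as decay for [lq_geo]. *)
Lemma hardy_left (r : \bar R) (theta e : R) (v : R -> R) : 0 < r ->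
  regvar (- (theta * (theta1 - theta0)))%R v -> (0 < e)%R ->
  (3 * e <= theta * (theta1 - theta0))%R ->
  exists2 D : R, (0 < D)%R & forall f k,
  (v (epoint k))%:E * I f k <= D%:E * M r e v (Kseq beta0 f) k.
Proof.
move=> r_gt0 hv e0 he; have [G G0 hG] := lq_geo r0 _ hr0 e0.
have [P P0 hP] := regvar_epoint _ _ (regvarV _ _ hv) _ e0.
exists (G * P)%R; first exact: mulr_gt0.
move=> f k; set Mk := M _ _ _ _ _; have M0 : 0 <= Mk by exact: lq_ge0.
have v0 j : (0 < v (epoint j))%R by apply: (proj1 hv); exact: epoint_gt0.
rewrite muleC -lee_pdivlMr//.
have -> : (G * P)%:E * Mk * ((v (epoint k))^-1)%:E =
    G%:E * ((P * (v (epoint k))^-1)%:E * Mk).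
  by rewrite !EFinM !muleA muleAC.
have PV0 : (0 <= P * (v (epoint k))^-1)%R by rewrite mulr_ge0 ?invr_ge0 ?ltW.
apply: (hG _ k); first exact: mule_ge0.
move=> j; rewrite /keep; case: ifPn => jk; last first.
  by rewrite mule_ge0 ?lee_fin ?expR_ge0// mule_ge0.
have hj : (expR (- (e * `|(k - j)%:~R|)) * v (epoint j))%:E * Kseq beta0 f j <= Mk.
  by rewrite EFinM -muleA /Mk /M; exact: lq_point.
have c0 : (0 < expR (- (e * `|(k - j)%:~R|)) * v (epoint j))%R.
  by rewrite mulr_gt0 ?expR_gt0.
rewrite -lee_pdivlMl// in hj; apply: (le_trans hj).
rewrite muleA -EFinM lee_wpmul2r// lee_fin invfM -expRN opprK.
apply: (@le_trans _ _ (expR (e * `|(k - j)%:~R|) * (P * expR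
   (- - (theta * (theta1 - theta0)) * (j - k)%:~R + e * `|(j - k)%:~R|) *
   (v (epoint k))^-1))%R).
  by rewrite ler_wpM2l ?expR_ge0.
rewrite (_ : expR (e * `|(k - j)%:~R|) * (P * expR
   (- - (theta * (theta1 - theta0)) * (j - k)%:~R + e * `|(j - k)%:~R|) *
   (v (epoint k))^-1) = expR (e * `|(k - j)%:~R| +
   (- - (theta * (theta1 - theta0)) * (j - k)%:~R + e * `|(j - k)%:~R|)) *
   (P * (v (epoint k))^-1))%R; last by rewrite [in RHS]expRD; ring.
rewrite ler_wpM2r// ler_expR -opprB rmorphN normrN normr_intB_le//.
have : ((j - k)%:~R <= 0 :> R)%R by rewrite lerz0 subr_le0.
by rewrite opprK; nra.
Qed.

(** [S = P m_k / v_k] is admissible in [holmstedt_upper] because [v rho] has the positive index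
    [(1 - theta) (theta1 - theta0)]; the three [e] go to the kernel of [M], the Potter error and the
    surplus factor. Keeping [z] abstract serves both cases: the sequence [x] when [theta > 0], and
    [I] when [theta = 0]. *)
Lemma holmstedt_upper_sum (r : \bar R) (theta e D : R) (v : R -> R) : 0 < r ->
  regvar (- (theta * (theta1 - theta0)))%R v -> (0 < e)%R -> (0 < D)%R ->
  (3 * e <= (1 - theta) * (theta1 - theta0))%R ->
  exists2 C : R, (0 < C)%R & forall f (z : int -> \bar R),
  sum_set A0 A1 f -> (forall j, Kseq beta0 f j <= z j) ->
  (forall k, (v (epoint k))%:E * I f k <= D%:E * M r e v z k) ->
  lq r (fun k => (v (epoint k))%:E * z k) < +oo ->
  sum_set X0 X1 f /\
  lq r (fun k => (v (epoint k))%:E * Kfun X0 X1 (rho (epoint k)) f) <=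
    C%:E * lq r (fun k => (v (epoint k))%:E * z k).
Proof.
move=> r_gt0 hv e0 D0 he; have [S S0 hS] := lq_schur r e r_gt0 e0.
have [P P0 hP] := regvar_epoint _ _ (regvarM _ _ _ _ hv regvar_rho) _ e0.
have [U U0 hU] := holmstedt_upper e e0.
exists (U * (D + P) * S)%R; first by rewrite !mulr_gt0// addr_gt0.
move=> f z sf xz vI zfin.
have v0 j : (0 < v (epoint j))%R by apply: (proj1 hv); exact: epoint_gt0.
have M0 k : 0 <= M r e v z k by exact: lq_ge0.
have MS : lq r (M r e v z) <= S%:E * lq r (fun k => (v (epoint k))%:E * z k).
  by apply: (hS id).
have Mfin k : M r e v z k \is a fin_num.
  rewrite ge0_fin_numE//; apply: (le_lt_trans (lq_point r (M r e v z) k r_gt0)).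
  apply: (le_lt_trans MS); apply: lte_mul_pinfty => //; rewrite ?lee_fin ?ltW//.
pose m k := fine (M r e v z k).
have mE k : M r e v z k = (m k)%:E by rewrite fineK.
have m0 k : (0 <= m k)%R by rewrite fine_ge0.
have vI' k : I f k <= (D * m k / v (epoint k))%:E.
  by rewrite [(_ / _)%R]mulrC EFinM lee_pdivlMl// EFinM -mE.
have key k : sum_set X0 X1 f /\ Kfun X0 X1 (rho (epoint k)) f <=
    U%:E * (I f k + (P * m k / v (epoint k))%:E).
  apply: hU => //.
  - by rewrite divr_ge0 ?mulr_ge0// ltW.
  - exact: le_lt_trans (vI' k) (ltry _).
  move=> j kj.
  have hj : (expR (- (e * `|(k - j)%:~R|)) * v (epoint j))%:E * Kseq beta0 f j <= (m k)%:E.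
    rewrite EFinM -muleA -mE; apply: le_trans (lq_point _ _ j r_gt0).
    by rewrite !lee_wpmul2l ?lee_fin ?expR_ge0 ?(ltW (v0 _)).
  have : Kseq beta0 f j \is a fin_num by rewrite fin_numM// K_fin.
  have : 0 <= Kseq beta0 f j by exact: Kseq_ge0.
  case: (Kseq beta0 f j) hj => [x| |]// hj x0 _.
  rewrite -EFinM lee_fin in hj; rewrite -EFinM lee_fin; rewrite lee_fin in x0.
  have vk := v0 k; have vj := v0 j; have rk := rho_gt0 k; have rj := rho_gt0 j.
  rewrite ler_pdivlMr//.
  have kjE : ((k - j)%:~R = - (j - k)%:~R :> R)%R by rewrite -rmorphN opprB.
  have nkj : (`|(k - j)%:~R| = (j - k)%:~R :> R)%R by rewrite kjE normrN normr_intB_ge.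
  have := hP k j; rewrite nkj kjE => h.
  rewrite nkj in hj.
  have d : (0 <= (j - k)%:~R :> R)%R by rewrite ler0z subr_ge0.
  apply: (@le_trans _ _ (P * (expR (- (e * (j - k)%:~R)) * v (epoint j) * x))%R);
    last by rewrite ler_wpM2l// ltW.
  rewrite (_ : rho (epoint k) / rho (epoint j) * expR (e * (j - k)%:~R) * x * v (epoint k) =
    (v (epoint k) * rho (epoint k)) * (expR (e * (j - k)%:~R) * x / rho (epoint j)))%R;
    last by field; rewrite gt_eqF.
  apply: (le_trans (ler_wpM2r _ h)).
    by apply: divr_ge0; [apply: mulr_ge0 => //; exact: expR_ge0|exact: ltW].
  set y := (j - k)%:~R in d *.
  set g := (_ * - y + _)%R.
  rewrite (_ : P * expR g * (v (epoint j) * rho (epoint j)) *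
     (expR (e * y) * x / rho (epoint j)) = P * (expR (g + e * y) * v (epoint j) * x))%R;
    last by rewrite [expR (g + e * y)]expRD; field; rewrite gt_eqF.
  rewrite ler_wpM2l ?(ltW P0)// ler_wpM2r// ler_wpM2r ?(ltW vj)// ler_expR /g.
  by have := ler_wpM2r d he; lra.
split; first by have [] := key 0%R.
rewrite EFinM -muleA.
apply: (@le_trans _ _ (lq r (fun k => (U * (D + P))%:E * M r e v z k))).
  apply: lq_le => // k; have [_ hk] := key k.
  apply: (@le_trans _ _ ((v (epoint k))%:E * (U%:E *
      ((D * m k / v (epoint k))%:E + (P * m k / v (epoint k))%:E)))).
    apply: lee_wpmul2l; first by rewrite lee_fin ltW.
    apply: (le_trans hk); apply: lee_wpmul2l; first by rewrite lee_fin ltW.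
    by rewrite leeD2r.
  rewrite mE -!EFinM lee_fin le_eqVlt; apply/orP; left; apply/eqP.
  by field; rewrite gt_eqF.
have UDP : (0 <= U * (D + P))%R := mulr_ge0 (ltW U0) (addr_ge0 (ltW D0) (ltW P0)).
by apply: (le_trans (lq_scale _ _ _ r_gt0 UDP)); apply: lee_wpmul2l.
Qed.

End holmstedt.

(** ** Discretization of the interpolation norms *)

Section discrete_spaces.
Context {R : realType} {E : lmodType R} {Y0 Y1 : qspace E}.
Local Open Scope ereal_scope.
Hypothesis Y0_ge0 : forall x, carrier Y0 x -> 0 <= qnorm Y0 x.
Hypothesis Y1_ge0 : forall x, carrier Y1 x -> 0 <= qnorm Y1 x.
Implicit Types (theta : R) (q r : \bar R) (f : E).

Let KY (beta : R -> R) f (u : R) := (beta u)%:E * Kfun Y0 Y1 u f.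

Lemma eq_haar_norm q (D : set R) (g h : R -> \bar R) :
  (forall u, D u -> g u = ((u `^ (- rinv q))%R%:E * h u)) ->
  Lq_norm q D g = haar_norm q D h.
Proof.
move=> gh; rewrite /haar_norm /Lq_norm; congr (Lnorm _ _ _).
by apply/funext => u; rewrite /patch; case: ifPn => // /[!inE]; exact: gh.
Qed.

Lemma Lq_norm_Kweighted theta q (b : R -> R) f (D : set R) :
  (forall u, D u -> (0 < u)%R) ->
  Lq_norm q D (Kweighted Y0 Y1 theta q b f) =
  haar_norm q D (KY (fun t => t `^ (- theta) * b t)%R f).
Proof.
move=> D0; apply: eq_haar_norm => u /D0 u0.
rewrite /Kweighted /KY muleA -EFinM; congr (_%:E * _).
by rewrite mulrA -powRD 1?addrC// (gt_eqF u0) implybT.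
Qed.

Lemma doubling_KY alpha beta : regvar alpha beta ->
  exists2 A : R, (0 < A)%R & forall f, doubling A (KY beta f).
Proof.
move=> hb; have [A A0 hA] := regvar_doubling _ _ hb.
exists (A * expR 1)%R; first by rewrite mulr_gt0 ?expR_gt0.
move=> f; apply: doublingM (hA) _ => //; exact: Kfun_doubling.
Qed.

Lemma interp_discrete alpha theta q (b : R -> R) : 0 < q ->
  regvar alpha (fun t => t `^ (- theta) * b t)%R ->
  exists2 C : R, (0 < C)%R & forall f,
  let N := lq q (KY (fun t => t `^ (- theta) * b t)%R f \o epoint) in
  qnorm (interp Y0 Y1 theta q b) f <= C%:E * N /\
  N <= C%:E * qnorm (interp Y0 Y1 theta q b) f.
Proof.
move=> q0 hb; have [A A0 hA] := doubling_KY _ _ hb.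
have [C C0 hC] := haar_norm_line q A q0 A0; exists C => // f /=.
rewrite Lq_norm_Kweighted; last by move=> u /=; rewrite in_itv/= andbT.
exact: hC.
Qed.

Let nested_le r (g : R -> R) (x y : int -> \bar R) (C D : R) : 0 < r ->
  (0 < D)%R -> (forall k, (0 <= g (epoint k))%R) ->
  (forall k, x k <= D%:E * y k) ->
  lq r (fun k => (g (epoint k))%:E * x k) <=
  D%:E * lq r (fun k => (g (epoint k))%:E * y k).
Proof.
move=> r0 D0 g0 xy; apply: le_trans (lq_scale _ _ _ r0 (ltW D0)).
by apply: lq_le => // k; rewrite muleCA lee_wpmul2l// lee_fin.
Qed.

(** The inner norm is itself [doubling] as a function of [t], so the outer norm can be sampled at
    [t = e^k], where the inner one becomes a norm over [j >= k]. *)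
Lemma interpR_discrete alpha beta sigma r q (a b : R -> R) : 0 < r -> 0 < q ->
  regvar alpha (fun t => t `^ (- sigma) * a t)%R ->
  regvar beta (fun t => b t / a t)%R ->
  exists2 C : R, (0 < C)%R & forall f,
  let N := lq r (fun k => (b (epoint k) / a (epoint k))%:E *
    lq q (keep (fun j => (k <= j)%R)
      (KY (fun t => t `^ (- sigma) * a t)%R f \o epoint))) in
  qnorm (interpR Y0 Y1 sigma r b q a) f <= C%:E * N /\
  N <= C%:E * qnorm (interpR Y0 Y1 sigma r b q a) f.
Proof.
move=> r0 q0 ha hba; have [A A0 hA] := doubling_KY _ _ ha.
have [B B0 hB] := regvar_doubling _ _ hba.
have [D D0 hD] := doubling_haar_norm_right q A q0 A0.
have [C1 C10 hC1] := haar_norm_line r (B * D)%R r0 (mulr_gt0 B0 D0).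
have [C2 C20 hC2] := haar_norm_right q A q0 A0.
exists (C1 * C2)%R; first exact: mulr_gt0.
move=> f /=; set N := lq r _; pose h := KY (fun t => t `^ (- sigma) * a t)%R f.
have -> : Lq_norm r `]0%R, +oo[ (fun t => (t `^ (- rinv r) * (b t / a t))%:E *
    Lq_norm q `]t, +oo[ (Kweighted Y0 Y1 sigma q a f)) =
    haar_norm r `]0%R, +oo[ (fun t => (b t / a t)%:E * haar_norm q `]t, +oo[ h).
  apply: eq_haar_norm => t /=; rewrite in_itv/= andbT => t0.
  rewrite Lq_norm_Kweighted ?EFinM ?muleA// => u /=.
  by rewrite in_itv/= andbT; exact: lt_trans.
have [|h1 h2] := hC1 (fun t => (b t / a t)%:E * haar_norm q `]t, +oo[ h).
  by apply: doublingM => //; apply: hD; exact: hA.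
have g0 k : (0 <= b (epoint k) / a (epoint k))%R.
  by apply/ltW/(proj1 hba); exact: epoint_gt0.
have hk k := hC2 _ (hA f) (epoint k) (epoint_gt0 k).
split.
  apply: le_mul_trans h1 _; first exact: ltW.
  apply: (nested_le r (fun t => b t / a t)%R) => // k.
  by have [] := hk k; rewrite log_floor_epoint.
rewrite mulrC; apply: le_mul_trans h2; first exact: ltW.
apply: (nested_le r (fun t => b t / a t)%R) => // k.
by have [] := hk k; rewrite log_floor_epoint.
Qed.

Lemma interpL_discrete alpha beta sigma r q (a b : R -> R) : 0 < r -> 0 < q ->
  regvar alpha (fun t => t `^ (- sigma) * a t)%R ->
  regvar beta (fun t => b t / a t)%R ->
  exists2 C : R, (0 < C)%R & forall f,
  let N := lq r (fun k => (b (epoint k) / a (epoint k))%:E *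
    lq q (keep (fun j => (j <= k)%R)
      (KY (fun t => t `^ (- sigma) * a t)%R f \o epoint))) in
  qnorm (interpL Y0 Y1 sigma r b q a) f <= C%:E * N /\
  N <= C%:E * qnorm (interpL Y0 Y1 sigma r b q a) f.
Proof.
move=> r0 q0 ha hba; have [A A0 hA] := doubling_KY _ _ ha.
have [B B0 hB] := regvar_doubling _ _ hba.
have [D D0 hD] := doubling_haar_norm_left q A q0 A0.
have [C1 C10 hC1] := haar_norm_line r (B * D)%R r0 (mulr_gt0 B0 D0).
have [C2 C20 hC2] := haar_norm_left q A q0 A0.
exists (C1 * C2)%R; first exact: mulr_gt0.
move=> f /=; set N := lq r _; pose h := KY (fun t => t `^ (- sigma) * a t)%R f.
have -> : Lq_norm r `]0%R, +oo[ (fun t => (t `^ (- rinv r) * (b t / a t))%:E *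
    Lq_norm q `]0%R, t[ (Kweighted Y0 Y1 sigma q a f)) =
    haar_norm r `]0%R, +oo[ (fun t => (b t / a t)%:E * haar_norm q `]0%R, t[ h).
  apply: eq_haar_norm => t /=; rewrite in_itv/= andbT => t0.
  rewrite Lq_norm_Kweighted ?EFinM ?muleA// => u /=.
  by rewrite in_itv/= => /andP[].
have [|h1 h2] := hC1 (fun t => (b t / a t)%:E * haar_norm q `]0%R, t[ h).
  by apply: doublingM => //; apply: hD; exact: hA.
have g0 k : (0 <= b (epoint k) / a (epoint k))%R.
  by apply/ltW/(proj1 hba); exact: epoint_gt0.
have hk k := hC2 _ (hA f) (epoint k) (epoint_gt0 k).
split.
  apply: le_mul_trans h1 _; first exact: ltW.
  apply: (nested_le r (fun t => b t / a t)%R) => // k.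
  by have [] := hk k; rewrite log_floor_epoint.
rewrite mulrC; apply: le_mul_trans h2; first exact: ltW.
apply: (nested_le r (fun t => b t / a t)%R) => // k.
by have [] := hk k; rewrite log_floor_epoint.
Qed.

End discrete_spaces.

(** * Embeddings and the two interpolation identities *)

Lemma embeddedP (R : realType) (E : lmodType R) (X0 X1 Y0 Y1 : qspace E)
    (N M : E -> \bar R) :
  (exists2 C : R, 0 < C & forall f, sum_set X0 X1 f -> (N f < +oo)%E ->
    sum_set Y0 Y1 f /\ (M f <= C%:E * N f)%E) ->
  (forall f, (0 <= N f)%E) ->
  embedded (finite_part X0 X1 N) (finite_part Y0 Y1 M).
Proof.
move=> [C C0 h] N0; split=> [f [sf Nf]|].
  have [sYf Mf] := h f sf Nf; split=> //; apply: (le_lt_trans Mf).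
  by apply: lte_mul_pinfty; rewrite ?lee_fin ?(ltW C0).
by exists C => f [sf Nf]; have [] := h f sf Nf.
Qed.


Theorem theorem19 (R : realType) (E : topologicalLmodType R) (A0 A1 : qspace E)
    (hA : compatible_couple A0 A1)
    (hA01 : exists x : E, [/\ carrier A0 x, carrier A1 x & x != 0])
    (theta0 theta1 : R)
    (htheta0 : 0 < theta0) (htheta01 : theta0 < theta1) (htheta1 : theta1 < 1)
    (q1 r0 r1 r : \bar R)
    (hq1 : (0 < q1)%E) (hr0 : (0 < r0)%E) (hr1 : (0 < r1)%E) (hr : (0 < r)%E)
    (a a1 b0 b1 : R -> R)
    (ha : slowly_varying a) (ha1 : slowly_varying a1)
    (hb0 : slowly_varying b0) (hb1 : slowly_varying b1)
    (hfin : (weight_norm r1 (fun s => (b1 s / a1 s)%R) `]0%R, 1%R[ < +oo)%E) :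
  let c1 := cfun r1 a1 b1 in
  let rho := rhofun theta0 theta1 b0 c1 in
  let X0 := interp A0 A1 theta0 r0 b0 in
  let X1 := interpR A0 A1 theta1 r1 b1 q1 a1 in
  (forall theta : R, 0 < theta -> theta < 1 ->
   forall ash : R -> R, positive_measurable ash ->
   equivalent ash
     (fun t => b0 t `^ (1 - theta) * c1 t `^ theta * a (rho t)) ->
   same_space (interp X0 X1 theta r a)
     (interp A0 A1 ((1 - theta) * theta0 + theta * theta1) r ash)) /\
  ((weight_norm r a `]1%R, +oo[ < +oo)%E ->
   forall ash : R -> R, positive_measurable ash ->
   equivalent ash (fun t => b0 t * a (rho t)) ->
   same_space (interp X0 X1 0 r a) (interpL A0 A1 theta0 r ash r0 b0)).
Proof.
move=> c1 rho X0 X1.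
have [_ qA0 qA1 _ _] := hA.
have nA0 x : carrier A0 x -> (0 <= qnorm A0 x)%E by exact: qnorm_ge0.
have nA1 x : carrier A1 x -> (0 <= qnorm A1 x)%E by exact: qnorm_ge0.
have [ra ra1] := (slowly_varying_regvar _ ha, slowly_varying_regvar _ ha1).
have [rb0 rb1] := (slowly_varying_regvar _ hb0, slowly_varying_regvar _ hb1).
pose w s := b1 s / a1 s.
have rw : regvar 0 w.
  by apply: (eq_regvar _ _ _ _ _ _ (regvarM _ _ _ _ rb1 (regvarV _ _ ra1))) => //; rewrite oppr0 addr0.
have [WE rW] := regvar_haar_norm_left r1 w hr1 rw hfin.
pose W s := fine (haar_norm r1 `]0, s[ (EFin \o w)).
pose beta0 t := t `^ (- theta0) * b0 t.
pose beta1 t := t `^ (- theta1) * a1 t.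
have rbeta0 : regvar (- theta0) beta0.
  by apply: (eq_regvar _ _ _ _ _ _ (regvarM _ _ _ _ (regvar_powR _) rb0)) => //; rewrite addr0.
have rbeta1 : regvar (- theta1) beta1.
  by apply: (eq_regvar _ _ _ _ _ _ (regvarM _ _ _ _ (regvar_powR _) ra1)) => //; rewrite addr0.
have hWw : exists2 C : R, 0 < C & forall k : int,
    (lq r1 (keep (fun i => (i <= k)%R) (EFin \o w \o epoint)) <= C%:E * (W (epoint k))%:E)%E /\
    ((W (epoint k))%:E <= C%:E * lq r1 (keep (fun i => (i <= k)%R) (EFin \o w \o epoint)))%E.
  have [A A_gt0 hdA] := regvar_doubling _ _ rw.
  have [C C0 hC] := haar_norm_left r1 A hr1 A_gt0; exists C => // k.
  have [h1 h2] := hC _ hdA _ (epoint_gt0 k).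
  by rewrite /W WE ?epoint_gt0// log_floor_epoint in h1 h2 *.
have nX0 x : (0 <= qnorm X0 x)%E by exact: Lnorm_ge0.
have nX1 x : (0 <= qnorm X1 x)%E by exact: Lnorm_ge0.
have hX0 : equivalent_on_sum (A0 := A0) (A1 := A1) X0
    (dnorm0 (A0 := A0) (A1 := A1) (r0 := r0) (beta0 := beta0)).
  split=> //; have [C C0 hC] := interp_discrete nA0 nA1 _ _ _ _ hr0 rbeta0.
  by exists C => // f _; exact: hC.
have hX1 : equivalent_on_sum (A0 := A0) (A1 := A1) X1
    (dnorm1 (A0 := A0) (A1 := A1) (r1 := r1) (q1 := q1) (beta1 := beta1) (w := w)).
  split=> //.
  have [C C0 hC] := interpR_discrete nA0 nA1 _ _ _ _ _ _ _ hr1 hq1 rbeta1 rw.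
  by exists C => // f _; exact: hC.
(* Equal to [rho] on the positive half-line ([rhoE]), since [c1 = a1 * W]. *)
pose rh t := beta0 t / (beta1 t * W t).
pose delta := theta1 - theta0.
pose x := Kseq (A0 := A0) (A1 := A1) beta0.
have delta0 : 0 < delta by rewrite subr_gt0.
have rrh : regvar delta rh by exact: regvar_rho rbeta0 rbeta1 rW.
have rh0 := proj1 rrh.
have W0 := proj1 rW.
have pos : [/\ forall t, 0 < t -> 0 < b0 t, forall t, 0 < t -> 0 < a1 t &
    forall t, 0 < t -> 0 < c1 t].
  split; [exact: (proj1 rb0)|exact: (proj1 ra1)|move=> t t0].
  by rewrite mulr_gt0 ?(proj1 ra1)//; exact: W0.
have [b0_gt0 a1_gt0 c1_gt0] := pos.
have powE s y : 0 < s -> s `^ y = expR (y * ln s) by move=> s0; rewrite /powR gt_eqF.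
have rhoE t : 0 < t -> rho t = rh t.
  move=> t0; have Wt := W0 t t0; have a1t := a1_gt0 t t0.
  rewrite /rho /rhofun /rh /beta0 /beta1 /c1 /cfun -[fine _]/(W t) !powE//.
  rewrite !mulNr !expRN mulrBl expRD expRN; field.
  by rewrite !gt_eqF ?expR_gt0.
(* The outer weight [u^(- theta) a(u)] at [u = rho(t)]. Its index in [t] is [- theta * delta],
   because [a] composed with [rho] is again slowly varying. *)
pose v theta t := rh t `^ (- theta) * a (rh t).
have rv theta : 0 <= theta -> regvar (- (theta * delta)) (v theta).
  have rarh : regvar 0 (fun t => a (rh t)) by exact: regvar_comp ra rrh.
  rewrite le_eqVlt => /predU1P[<-|theta_gt0].
    apply: (eq_regvar _ _ _ _ _ _ rarh); last by rewrite mul0r oppr0.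
    by move=> t t0; rewrite /v oppr0 powRr0 mul1r.
  apply: (eq_regvar _ _ _ _ _ _ (regvarM _ _ _ _
    (regvarV _ _ (regvar_pow _ _ _ theta_gt0 rrh)) rarh)).
    by move=> t t0; rewrite /v powRN.
  by rewrite addr0 mulrC.
have sumX f : sum_set X0 X1 f -> sum_set A0 A1 f.
  by move=> [f0 [f1 [[sf0 _] [sf1 _] ->]]]; exact: sum_setD.
have normX theta : exists2 C : R, 0 < C & forall f,
    (qnorm (interp X0 X1 theta r a) f <=
      C%:E * lq r (fun k => (v theta (epoint k))%:E * Kfun X0 X1 (rh (epoint k)) f))%E /\
    (lq r (fun k => (v theta (epoint k))%:E * Kfun X0 X1 (rh (epoint k)) f) <=
      C%:E * qnorm (interp X0 X1 theta r a) f)%E.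
  have rta : regvar (- theta) (fun t => t `^ (- theta) * a t).
    by apply: (eq_regvar _ _ _ _ _ _ (regvarM _ _ _ _ (regvar_powR _) ra)) => //; rewrite addr0.
  have [C C0 hC] := interp_discrete (fun x _ => nX0 x) (fun x _ => nX1 x) _ _ _ _ hr rta.
  have [A A_gt0 hdA] := doubling_KY (fun x _ => nX0 x) (fun x _ => nX1 x) _ _ rta.
  (* The summand is [doubling] in [u], so sampling at [u = e^k] may be exchanged for sampling at
     [u = rho_k]. *)
  have [D D0 hD] := lq_regvar_reindex r A delta rh hr A_gt0 delta0 rrh.
  exists (C * D) => [|f]; first exact: mulr_gt0.
  have [h1 h2] := hC f; have [h3 h4] := hD _ (hdA f); split.
    by apply: le_mul_trans h1 h3; exact: ltW.
  by rewrite mulrC; apply: le_mul_trans h4 h2; exact: ltW.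
have [L L0 hL] := holmstedt_lower qA0 qA1 htheta01 hr0 hr1 hq1 rbeta0 rbeta1 rw rW hWw hX0 hX1.
split.
- move=> theta theta_gt0 theta_lt1 ash [_ ash0] hash.
  set eta := (1 - theta) * theta0 + theta * theta1.
  pose zeta t := t `^ (- eta) * ash t.
  (* The origin of [eta] and [a#]: the target weight factors as [v * beta0], so the target norm is
     the [l^r] norm of [v_k x_k]. *)
  have gE t : 0 < t -> t `^ (- eta) * (b0 t `^ (1 - theta) * c1 t `^ theta * a (rho t)) =
      v theta t * beta0 t.
    move=> t0; have bt := b0_gt0 t t0; have ct := c1_gt0 t t0.
    have lnrh : ln (rh t) = delta * ln t + ln (b0 t) - ln (c1 t).
      rewrite -rhoE// /rho /rhofun lnM ?posrE ?powR_gt0 ?divr_gt0// ln_powR.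
      by rewrite ln_div ?posrE// addrA.
    have bE : b0 t = expR (ln (b0 t)) by rewrite lnK ?posrE.
    rewrite rhoE// /v /beta0 !powE ?rh0// lnrh; move: (a _) => y.
    transitivity (expR (- eta * ln t + (1 - theta) * ln (b0 t) + theta * ln (c1 t)) * y).
      by rewrite !expRD; ring.
    rewrite (_ : - eta * ln t + (1 - theta) * ln (b0 t) + theta * ln (c1 t) =
      - theta * (delta * ln t + ln (b0 t) - ln (c1 t)) +
      (- theta0 * ln t + ln (b0 t))); last by rewrite /eta /delta; ring.
    by rewrite 2!expRD -bE; ring.
  have zetaE : equivalent zeta (fun t => v theta t * beta0 t).
    have [D D0 hD] := hash; exists D => // t t0; have [h1 h2] := hD t t0.
    by rewrite -gE// /zeta ![D * (t `^ _ * _)]mulrCA !ler_pM2l ?powR_gt0.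
  have rvb := regvarM _ _ _ _ (rv theta (ltW theta_gt0)) rbeta0.
  have zeta0 t : 0 < t -> 0 < zeta t by move=> t0; rewrite mulr_gt0 ?powR_gt0 ?ash0.
  have rzeta := equivalent_regvar _ _ _ zeta0 zetaE rvb.
  have [C C0 hC] := interp_discrete nA0 nA1 _ _ _ _ hr rzeta.
  have [C' C'0 hC'] := normX theta; have [D D0 hD] := zetaE.
  have v0 k : 0 < v theta (epoint k).
    by apply: (proj1 (rv theta (ltW theta_gt0))); exact: epoint_gt0.
  split; apply: embeddedP.
  + exists (C * ((D * L) * C')); first by rewrite !mulr_gt0.
    move=> f sf _; split; first exact: sumX.
    apply: le_mul_trans (proj1 (hC f)) _; first exact: ltW.
    apply: le_mul_trans _ (proj2 (hC' f)); first by rewrite mulr_ge0 ?ltW.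
    apply: lq_dom => // [|k]; first by rewrite mulr_ge0 ?ltW.
    have [h1 _] := hD _ (epoint_gt0 k).
    apply: (@le_trans _ _ ((D * v theta (epoint k))%:E * x f k)%E).
      rewrite /= /x /Kseq muleA -EFinM; apply: lee_wpmul2r.
        by apply: Kfun_ge0 => //; rewrite ltW// epoint_gt0.
      by rewrite lee_fin -mulrA.
    apply: (@le_trans _ _ ((D * v theta (epoint k))%:E *
        (L%:E * Kfun X0 X1 (rh (epoint k)) f))%E).
      apply: lee_wpmul2l; first by rewrite lee_fin; exact: mulr_ge0 (ltW D0) (ltW (v0 _)).
      (* Of [I_k] only the term [x_k] is kept. *)
      apply: le_trans (hL f k).
      have := lq_point r0 (keep (fun j => (j <= k)%R) (x f)) k hr0.
      by rewrite {1}/keep lexx.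
    by rewrite !muleA -!EFinM (mulrAC D).
  + by move=> f; exact: Lnorm_ge0.
  (* A third of both margins: [theta * delta] for [hardy_left] and [(1 - theta) * delta] for
     [holmstedt_upper_sum], each of which spends [e] three times. *)
  + pose e := Num.min theta (1 - theta) * delta / 3.
    have m0 : 0 < Num.min theta (1 - theta) by rewrite lt_min theta_gt0 subr_gt0.
    have e0 : 0 < e by rewrite divr_gt0// mulr_gt0.
    have e3 : 3 * e = Num.min theta (1 - theta) * delta by rewrite /e; field.
    have e1 : 3 * e <= theta * delta by rewrite e3 ler_wpM2r ?(ltW delta0)// ge_min lexx.
    have e2 : 3 * e <= (1 - theta) * delta.
      by rewrite e3 ler_wpM2r ?(ltW delta0)// ge_min lexx orbT.
    have rvt := rv theta (ltW theta_gt0).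
    have [F F0 hF] := hardy_left (A0 := A0) (A1 := A1) (beta0 := beta0) hr0 _ _ _ _ hr rvt e0 e1.
    have [G G0 hG] := holmstedt_upper_sum qA0 qA1 htheta0 htheta01 htheta1 hr0 hr1 hq1
      rbeta0 rbeta1 rw rW hWw hX0 hX1 _ _ _ _ _ hr rvt e0 F0 e2.
    exists (C' * (G * (D * C))); first by rewrite !mulr_gt0.
    move=> f sf Nf.
    have vx : (lq r (fun k => (v theta (epoint k))%:E * x f k) <=
        (D * C)%:E * qnorm (interp A0 A1 eta r ash) f)%E.
      apply: le_mul_trans _ (proj2 (hC f)); first exact: ltW.
      apply: lq_dom => // [|k]; first exact: ltW.
      have [_ h2] := hD _ (epoint_gt0 k).
      rewrite /= /x /Kseq !muleA -!EFinM; apply: lee_wpmul2r; last by rewrite lee_fin.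
      by apply: Kfun_ge0 => //; rewrite ltW// epoint_gt0.
    have [|sX kX] := hG f (x f) sf (fun=> lexx _) (hF f).
      apply: (le_lt_trans vx); apply: lte_mul_pinfty => //.
      by rewrite lee_fin; exact: mulr_ge0 (ltW D0) (ltW C0).
    split=> //.
    apply: le_mul_trans (proj1 (hC' f)) _; first exact: ltW.
    by apply: le_mul_trans kX vx; exact: ltW.
  + by move=> f; exact: Lnorm_ge0.
move=> _ ash [_ ash0] hash.
(* The outer weight of the [L] space, equivalent to [a(rho)], which is [v] at [theta = 0]. *)
pose zeta t := ash t / b0 t.
have zetaE : equivalent zeta (v 0).
  have [D D0 hD] := hash; exists D => // t t0; have [h1 h2] := hD t t0.
  have bt := b0_gt0 t t0; rewrite /zeta /v oppr0 powRr0 mul1r -rhoE//.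
  by rewrite ler_pdivrMr// mulrA ler_pdivlMr// -[D * _ * _]mulrA ![a _ * _]mulrC.
have rv0 := rv 0 (lexx _).
have zeta0 t : 0 < t -> 0 < zeta t by move=> t0; rewrite divr_gt0 ?ash0 ?b0_gt0.
have rzeta := equivalent_regvar _ _ _ zeta0 zetaE rv0.
have [C C0 hC] := interpL_discrete nA0 nA1 _ _ _ _ _ _ _ hr hr0 rbeta0 rzeta.
have [C' C'0 hC'] := normX 0; have [D D0 hD] := zetaE.
have v0 k : 0 < v 0 (epoint k) by apply: (proj1 rv0); exact: epoint_gt0.
pose I f k := lq r0 (keep (fun j => (j <= k)%R) (x f)).
have I0 f k : (0 <= I f k)%E by exact: lq_ge0.
split; apply: embeddedP.
- exists (C * ((D * L) * C')); first by rewrite !mulr_gt0.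
  move=> f sf _; split; first exact: sumX.
  apply: le_mul_trans (proj1 (hC f)) _; first exact: ltW.
  apply: le_mul_trans _ (proj2 (hC' f)); first by rewrite mulr_ge0 ?ltW.
  apply: lq_dom => // [|k]; first by rewrite mulr_ge0 ?ltW.
  have [h1 _] := hD _ (epoint_gt0 k).
  apply: (@le_trans _ _ ((D * v 0 (epoint k))%:E * I f k)%E).
    by apply: (@lee_wpmul2r _ (I f k)) => //; rewrite lee_fin.
  apply: (@le_trans _ _ ((D * v 0 (epoint k))%:E *
      (L%:E * Kfun X0 X1 (rh (epoint k)) f))%E).
    apply: lee_wpmul2l; first by rewrite lee_fin; exact: mulr_ge0 (ltW D0) (ltW (v0 _)).
    exact: hL.
  by rewrite !muleA -!EFinM (mulrAC D).
- by move=> f; exact: Lnorm_ge0.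
- pose e := delta / 3.
  have e0 : 0 < e by rewrite divr_gt0.
  have e2 : 3 * e <= (1 - 0) * delta by rewrite /e; lra.
  have [G G0 hG] := holmstedt_upper_sum qA0 qA1 htheta0 htheta01 htheta1 hr0 hr1 hq1
    rbeta0 rbeta1 rw rW hWw hX0 hX1 _ _ _ _ _ hr rv0 e0 ltr01 e2.
  exists (C' * (G * (D * C))); first by rewrite !mulr_gt0.
  move=> f sf Nf.
  have vx : (lq r (fun k => (v 0 (epoint k))%:E * I f k) <=
      (D * C)%:E * qnorm (interpL A0 A1 theta0 r ash r0 b0) f)%E.
    apply: le_mul_trans _ (proj2 (hC f)); first exact: ltW.
    apply: lq_dom => // [|k]; first exact: ltW.
    have [_ h2] := hD _ (epoint_gt0 k).
    by rewrite muleA -EFinM; apply: (@lee_wpmul2r _ (I f k)) => //; rewrite lee_fin.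
  (* With [z = I]: [x_j] is a term of [I_j], and [v_k I_k] is the term [j = k] of the smoothed norm,
     hence the constant [1]. *)
  have [||| sX kX] := hG f (I f) sf.
  + move=> j; have := lq_point r0 (keep (fun i => (i <= j)%R) (x f)) j hr0.
    by rewrite {1}/keep lexx.
  + move=> k; rewrite mul1e; apply: le_trans (lq_point _ _ k hr).
    by rewrite subrr normr0 mulr0 oppr0 expR0 mul1e.
  + apply: (le_lt_trans vx); apply: lte_mul_pinfty => //.
      by rewrite lee_fin; exact: mulr_ge0 (ltW D0) (ltW C0).
  split=> //.
  apply: le_mul_trans (proj1 (hC' f)) _; first exact: ltW.
  by apply: le_mul_trans kX vx; exact: ltW.
- by move=> f; exact: Lnorm_ge0.
Qed.
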